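(* Let $\mathrm{R}$ be a real closed field. Let $M$ be the basic closed semi-algebraic set \[ M:=\{x \in \mathrm{R}^n \mid g_i(x) \le 0,\ h_j(x) = 0,\ i=1,\ldots,r,\ j=1,\ldots,s\}, \] where $g_i,h_j \in \mathrm{R}[X_1,\ldots, X_n]$ have degrees at most $d$, and let $E$ be a closed and bounded $\mathcal{P}$-semi-algebraic subset of $\mathrm{R}^n$ with $\mathcal{P} \subset \mathrm{R}[X_1,\ldots,X_n]$ a finite set of polynomials of degrees at most $d$. Let $\psi: M \cup E \rightarrow \mathrm{R}_{\ge 0}$ be the semi-algebraic function defined by \[ \psi(x)=\sum_{j=1}^s |h_j(x)| + \sum_{i=1}^r \max\{g_i(x),0\}. \] Then there exist a positive constant $\kappa$ and an integer $\rho \ge 1$ with $\rho=d^{O(n^2)}$ such that \[ \mathrm{dist}(x,M)^{\rho} \le \kappa \cdot \psi(x) \quad \text{for all } x \in E. \] Moreover, if $\dim M = 0$ (i.e. $M$ is a finite subset of $\mathrm{R}^n$), then this inequality holds with $\rho \le (8d)^{2(n+7)} = d^{O(n)}$.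
   Context: A $\mathcal{P}$-semi-algebraic set is the set of points satisfying a quantifier-free first-order formula whose atoms are of the form $P=0$, $P>0$, $P<0$ with $P \in \mathcal{P}$. $\mathrm{dist}(x,M)$ denotes the (Euclidean) distance from $x$ to $M$. An inequality of the form $\mathrm{dist}(x,M)^{\rho} \le \kappa \cdot \psi(x)$ for all $x\in E$, with $\psi(x)=0$ iff $x\in M$, is called an error bound on $E$ with respect to $M$ with residual function $\psi$. *)

(* Defs.v *)
From HB Require Import structures.
From mathcomp Require Import all_boot all_order all_algebra.
From mathcomp Require Import mpoly.
Set Implicit Arguments. Unset Strict Implicit. Unset Printing Implicit Defensive.
Import Order.TTheory GRing.Theory Num.Theory.
Local Open Scope ring_scope.

Section SemiAlg.
Variables (R : rcfType) (n : nat).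

Definition pt := 'rV[R]_n.

Definition peval (p : {mpoly R[n]}) (x : pt) : R := p.@[fun i => x ord0 i].

(* total degree of p is at most d (msize p = 1 + total degree, msize 0 = 0) *)
Definition deg_le (p : {mpoly R[n]}) (d : nat) : bool := (msize p <= d.+1)%N.

Definition edist (x y : pt) : R := Num.sqrt (\sum_(i < n) (x ord0 i - y ord0 i) ^+ 2).

Definition is_dist (x : pt) (M : pt -> Prop) (delta : R) : Prop :=
  (forall y, M y -> delta <= edist x y) /\
  (forall b, (forall y, M y -> b <= edist x y) -> b <= delta).

Definition closed_set (S : pt -> Prop) : Prop :=
  forall x, ~ S x -> exists2 e : R, 0 < e & forall y, edist x y < e -> ~ S y.
Definition bounded_set (S : pt -> Prop) : Prop :=
  exists B : R, forall x, S x -> edist x 0 <= B.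

Inductive sign_atom := SEq | SGt | SLt.
Inductive qf_formula :=
  | QAtom of {mpoly R[n]} & sign_atom
  | QTrue | QFalse
  | QNot of qf_formula
  | QAnd of qf_formula & qf_formula
  | QOr of qf_formula & qf_formula.

Fixpoint qf_holds (f : qf_formula) (x : pt) : Prop :=
  match f with
  | QAtom p SEq => peval p x = 0
  | QAtom p SGt => peval p x > 0
  | QAtom p SLt => peval p x < 0
  | QTrue => True
  | QFalse => False
  | QNot g => ~ qf_holds g x
  | QAnd g h => qf_holds g x /\ qf_holds h x
  | QOr g h => qf_holds g x \/ qf_holds h x
  end.

Fixpoint qf_over (P : seq {mpoly R[n]}) (f : qf_formula) : Prop :=
  match f with
  | QAtom p _ => p \in P
  | QTrue | QFalse => True
  | QNot g => qf_over P g
  | QAnd g h | QOr g h => qf_over P g /\ qf_over P h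
  end.

Definition P_semialgebraic (P : seq {mpoly R[n]}) (S : pt -> Prop) : Prop :=
  exists2 f, qf_over P f & forall x, S x <-> qf_holds f x.

Definition basic_closed r s (g : 'I_r -> {mpoly R[n]}) (h : 'I_s -> {mpoly R[n]})
  (x : pt) : Prop :=
  (forall i, peval (g i) x <= 0) /\ (forall j, peval (h j) x = 0).

Definition residual r s (g : 'I_r -> {mpoly R[n]}) (h : 'I_s -> {mpoly R[n]})
  (x : pt) : R :=
  \sum_(j < s) `|peval (h j) x| + \sum_(i < r) Num.max (peval (g i) x) 0.

Definition error_bound (E M : pt -> Prop) (psi : pt -> R) (rho : nat) (kappa : R)
  : Prop :=
  forall x, E x -> forall delta, is_dist x M delta -> delta ^+ rho <= kappa * psi x.

End SemiAlg.

(* Main.v *)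
Require Import Defs.
From HB Require Import structures.
From mathcomp Require Import all_boot all_order all_algebra.
From mathcomp Require Import mpoly polyrcf.
From mathcomp Require ordered_qelim qe_rcf.
From mathcomp Require Import ring lra zify.
From Stdlib Require Import Classical ClassicalEpsilon FunctionalExtensionality.
Set Implicit Arguments. Unset Strict Implicit. Unset Printing Implicit Defensive.
Import Order.TTheory GRing.Theory Num.Theory.
Local Open Scope ring_scope.

(** Put [phi = sum_j h_j^2 + sum_i max(g_i, 0)^2].  Near each point [phi] is
    touched from above by one of finitely many polynomials [f] of degree at most
    [2 d], and [phi <= psi^2].  The whole statement follows from a gradient
    inequality [c f^(2N-1) <= |grad f|^(2N)] near the zeros of [f] in a box, with
    [N] single exponential: if [phi > 0] on the ball of radius [r] about [x], then
    at a minimum of [phi / (r^2 - |y - x|^2)^(2N)] over that ball the gradient of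
    [f] is explicit, and the inequality gives [r^(2N) <= C phi(x)].  This avoids
    gradient flows, which are not available over a real closed field.

    For the gradient inequality, consider the polynomials
    [(w f - 1)^2 + l |grad f|^2 + c sum_i y_i^K] in [y], with [K > 2 deg f].  For
    [w = 1 / f(y)], the largest [l] for which the minimum is at most a constant
    [a] is at least of order [1 / |grad f(y)|^2], and is attained at a critical
    point of value [a].  The critical equations express [y_i^(K-1)] by monomials
    of lower degree, so a characteristic polynomial of size [(K-1)^n] gives an
    algebraic relation [chi(w, l) = 0] of bounded degree in [l], whatever the
    number of constraints.  Its Newton polygon yields [l^q <= C w^(2q-1)] or
    [w^(2q) <= C l^q] with [q] at most that degree.  The second case is excluded
    by the qualitative fact that [|grad f| / f] tends to infinity as [f] tends to
    [0+] on a box.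

    That fact is proved by tameness of semi-algebraic functions of one variable:
    otherwise a semi-algebraic curve [y(v)] with [f(y(v)) = v] and
    [|grad f| <= T v] would have a coordinate with derivative at least [c / v],
    and could not be bounded.  *)

(** * Semi-algebraic predicates *)

Module ord := ordered_qelim.ord.

Section Definable.
Variable R : rcfType.
Notation env := (nat -> R).

(** Environments are read as de Bruijn contexts: the variable bound last sits at index [0]. *)
Definition scons (x : R) (e : env) : env := fun k => if k is k'.+1 then e k' else x.

Inductive pfun : (env -> R) -> Prop :=
| pfun_var k : pfun (fun e => e k)
| pfun_cst c : pfun (fun=> c)
| pfunD F G : pfun F -> pfun G -> pfun (fun e => F e + G e)
| pfunM F G : pfun F -> pfun G -> pfun (fun e => F e * G e).

(** Boolean combinations of polynomial inequalities, taken up to logical equivalence through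
    [sa_iff]; closure under quantifiers is recovered in [sa_ex_scons]. *)
Inductive sa : (env -> Prop) -> Prop :=
| sa_gt0 F : pfun F -> sa (fun e => 0 < F e)
| sa_not P : sa P -> sa (fun e => ~ P e)
| sa_and P Q : sa P -> sa Q -> sa (fun e => P e /\ Q e)
| sa_iff P Q : (forall e, P e <-> Q e) -> sa P -> sa Q.

Lemma pfunN F : pfun F -> pfun (fun e => - F e).
Proof.
move=> hF; have -> : (fun e => - F e) = (fun e => -1 * F e).
  by apply: functional_extensionality => e; rewrite mulN1r.
by apply: pfunM => //; apply: pfun_cst.
Qed.

Lemma pfunX F k : pfun F -> pfun (fun e => F e ^+ k).
Proof.
move=> hF; elim: k => [|k IH]; first exact: pfun_cst.
have -> : (fun e => F e ^+ k.+1) = (fun e => F e * F e ^+ k).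
  by apply: functional_extensionality => e; rewrite exprS.
exact: pfunM.
Qed.

Lemma pfun_sum I (s : seq I) (P : pred I) (F : I -> env -> R) :
  (forall i, pfun (F i)) -> pfun (fun e => \sum_(i <- s | P i) F i e).
Proof.
move=> hF; elim: s => [|i s IH].
  rewrite (_ : (fun _ => _) = fun=> 0); first exact: pfun_cst.
  by apply: functional_extensionality => e; rewrite big_nil.
case Pi: (P i).
  rewrite (_ : (fun _ => _) = fun e => F i e + \sum_(i <- s | P i) F i e).
    exact: pfunD.
  by apply: functional_extensionality => e; rewrite big_cons Pi.
rewrite (_ : (fun _ => _) = fun e => \sum_(i <- s | P i) F i e) //.
by apply: functional_extensionality => e; rewrite big_cons Pi.
Qed.

Lemma pfun_prod I (s : seq I) (P : pred I) (F : I -> env -> R) :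
  (forall i, pfun (F i)) -> pfun (fun e => \prod_(i <- s | P i) F i e).
Proof.
move=> hF; elim: s => [|i s IH].
  rewrite (_ : (fun _ => _) = fun=> 1); first exact: pfun_cst.
  by apply: functional_extensionality => e; rewrite big_nil.
case Pi: (P i).
  rewrite (_ : (fun _ => _) = fun e => F i e * \prod_(i <- s | P i) F i e).
    exact: pfunM.
  by apply: functional_extensionality => e; rewrite big_cons Pi.
rewrite (_ : (fun _ => _) = fun e => \prod_(i <- s | P i) F i e) //.
by apply: functional_extensionality => e; rewrite big_cons Pi.
Qed.

Lemma sa_or P Q : sa P -> sa Q -> sa (fun e => P e \/ Q e).
Proof.
move=> hP hQ; apply: (@sa_iff (fun e => ~ (~ P e /\ ~ Q e))).
  by move=> e; split; tauto.
by apply/sa_not/sa_and; apply: sa_not.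
Qed.

Lemma sa_imp P Q : sa P -> sa Q -> sa (fun e => P e -> Q e).
Proof.
move=> hP hQ; apply: (@sa_iff (fun e => ~ P e \/ Q e)).
  by move=> e; split; tauto.
by apply: sa_or => //; apply: sa_not.
Qed.

Lemma sa_eq0 F : pfun F -> sa (fun e => F e = 0).
Proof.
move=> hF; apply: (@sa_iff (fun e => ~ (0 < F e) /\ ~ (0 < - F e))).
  move=> e; rewrite oppr_gt0; split; last by move->; rewrite ltxx.
  by case=> /negP h1 /negP h2; apply/eqP; rewrite eq_le !leNgt h1 h2.
by apply: sa_and; apply/sa_not/sa_gt0 => //; apply: pfunN.
Qed.

Lemma sa_bool (b : bool) : sa (fun=> b).
Proof.
apply: (@sa_iff (fun=> (0 < b%:R :> R))); last exact/sa_gt0/pfun_cst.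
by move=> e; case: b; rewrite ?ltr01 ?ltxx.
Qed.

Lemma pfun_subst (s : nat -> env -> R) F : (forall k, pfun (s k)) -> pfun F ->
  pfun (fun e => F (fun k => s k e)).
Proof.
move=> hs; elim=> [k|c|G H _ IG _ IH|G H _ IG _ IH].
- exact: hs.
- exact: pfun_cst.
- exact: pfunD.
- exact: pfunM.
Qed.

Lemma sa_subst (s : nat -> env -> R) P : (forall k, pfun (s k)) -> sa P ->
  sa (fun e => P (fun k => s k e)).
Proof.
move=> hs; elim=> [F hF|Q _ IH|Q Q' _ IQ _ IQ'|Q Q' QQ' _ IH].
- exact/sa_gt0/pfun_subst.
- exact: sa_not.
- exact: sa_and.
- by apply: sa_iff IH => e; apply: QQ'.
Qed.

(** Syntax is evaluated on finite lists, environments are infinite: [N] is any bound on the indices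
    of the variables that occur. *)
Lemma pfun_term F : pfun F -> exists t : GRing.term R, exists N, forall e n,
  (N <= n)%N -> GRing.eval (mkseq e n) t = F e.
Proof.
elim=> [k|c|G H _ [t [N h]] _ [t' [N' h']]|G H _ [t [N h]] _ [t' [N' h']]].
- by exists (GRing.Var _ k), k.+1 => e n kn /=; rewrite nth_mkseq.
- by exists (GRing.Const c), 0%N.
- exists (GRing.Add t t'), (maxn N N') => e n /=.
  by rewrite geq_max => /andP[/h -> /h' ->].
- exists (GRing.Mul t t'), (maxn N N') => e n /=.
  by rewrite geq_max => /andP[/h -> /h' ->].
Qed.

Lemma sa_formula P : sa P -> exists f : ord.formula R, exists N, forall e n,
  (N <= n)%N -> (ord.holds (mkseq e n) f <-> P e).
Proof.
elim=> [F /pfun_term[t [N h]]|Q _ [f [N h]]|Q Q' _ [f [N h]] _ [f' [N' h']]|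
  Q Q' QQ' _ [f [N h]]].
- exists (ord.Lt (GRing.NatConst _ 0) t), N => e n /h /= ->.
  by [].
- exists (ord.Not f), N => e n /(h e) /= ->; by [].
- exists (ord.And f f'), (maxn N N') => e n /=.
  by rewrite geq_max => /andP[/h -> /h' ->].
- by exists f, N => e n /(h e) ->.
Qed.

(** The condition [rterm] rules out inverses, so only polynomial operations remain; variables of
    index at least [n] read the default [0] of the list. *)
Lemma term_pfun (t : GRing.term R) n : GRing.rterm t ->
  pfun (fun e => GRing.eval (mkseq e n) t).
Proof.
elim: t => //=.
- move=> k _; case: (ltnP k n) => kn.
    rewrite (_ : (fun _ => _) = fun e => e k); first exact: pfun_var.
    by apply: functional_extensionality => e; rewrite nth_mkseq.
  rewrite (_ : (fun _ => _) = fun e => 0); first exact: pfun_cst.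
  by apply: functional_extensionality => e; rewrite nth_default ?size_mkseq.
- by move=> c _; exact: pfun_cst.
- by move=> c _; exact: pfun_cst.
- by move=> t It t' It' /andP[/It ? /It' ?]; apply: pfunD.
- by move=> t It /It ?; apply: pfunN.
- move=> t It k /It ?; rewrite (_ : (fun _ => _) =
    fun e => k%:R * GRing.eval (mkseq e n) t).
    by apply: pfunM => //; apply: pfun_cst.
  by apply: functional_extensionality => e; rewrite mulr_natl.
- by move=> t It t' It' /andP[/It ? /It' ?]; apply: pfunM.
- by move=> t It k /It ?; apply: pfunX.
Qed.

Lemma pfunB F G : pfun F -> pfun G -> pfun (fun e => F e - G e).
Proof. by move=> hF hG; apply: pfunD => //; apply: pfunN. Qed.

Lemma formula_sa (f : ord.formula R) n : ord.qf_form f && ord.rformula f ->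
  sa (fun e => ord.qf_eval (mkseq e n) f).
Proof.
elim: f => //=.
- by move=> b _; apply: sa_bool.
- move=> t t' /andP[h h']; apply: (@sa_iff (fun e =>
    GRing.eval (mkseq e n) t - GRing.eval (mkseq e n) t' = 0)).
    by move=> e; split => [/eqP|/eqP ->]; rewrite ?subrr // subr_eq0.
  by apply/sa_eq0/pfunB; apply: term_pfun.
- move=> t t' /andP[h h']; apply: (@sa_iff (fun e =>
    0 < GRing.eval (mkseq e n) t' - GRing.eval (mkseq e n) t)).
    by move=> e; rewrite subr_gt0.
  by apply/sa_gt0/pfunB; apply: term_pfun.
- move=> t t' /andP[h h']; apply: (@sa_iff (fun e =>
    ~ (0 < GRing.eval (mkseq e n) t - GRing.eval (mkseq e n) t'))).
    by move=> e; rewrite subr_gt0 leNgt; split => /negP.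
  by apply/sa_not/sa_gt0/pfunB; apply: term_pfun.
- move=> f If g Ig /andP[/andP[a b] /andP[c d]].
  apply: (@sa_iff _ _ (fun e => @rwP _ _ andP)).
  by apply: sa_and; [apply: If; rewrite a|apply: Ig; rewrite b].
- move=> f If g Ig /andP[/andP[a b] /andP[c d]].
  apply: (@sa_iff _ _ (fun e => @rwP _ _ orP)).
  by apply: sa_or; [apply: If; rewrite a|apply: Ig; rewrite b].
- move=> f If g Ig /andP[/andP[a b] /andP[c d]].
  apply: (@sa_iff _ _ (fun e => @rwP _ _ implyP)).
  by apply: sa_imp; [apply: If; rewrite a|apply: Ig; rewrite b].
- move=> f If /andP[a b]; apply: (@sa_iff _ _ (fun e => @rwP _ _ negP)).
  by apply/sa_not/If; rewrite a.
Qed.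

Lemma pfun_scons (c : R) k : pfun (fun e => scons c e k).
Proof. by case: k => [|k]; [apply: pfun_cst|apply: pfun_var]. Qed.

(** The predicate is turned into a first-order formula, its quantifier is eliminated over the real
    closed field, and the quantifier-free result is read back as a predicate. *)
Lemma sa_ex_scons P : sa P -> sa (fun e => exists x, P (scons x e)).
Proof.
move=> /sa_formula[f [N h]].
have mk x e : mkseq (scons x e) N.+1 = x :: mkseq e N.
  by rewrite /mkseq /= -[1%N]addn0 iotaDl -map_comp.
pose g := ord.quantifier_elim (fun i bc => qe_rcf.qfr_to_formula (@qe_rcf.wproj R i bc))
  (ord.to_rform (ord.Exists 0 f)).
have hg : ord.qf_form g && ord.rformula g.
  by apply: ord.quantifier_elim_wf; [exact: qe_rcf.wf_QE_wproj|exact: ord.to_rform_rformula].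
(* The eliminated formula is still evaluated with a slot for the bound variable; that slot is filled
   with [0]. *)
have := @sa_subst (fun k e => scons 0 e k) _ (pfun_scons 0) (formula_sa N.+1 hg).
apply: sa_iff => e.
have := qe_rcf.rcf_satP (0 :: mkseq e N) (ord.Exists 0 f).
rewrite /qe_rcf.rcf_sat /ord.proj_sat -/g.
rewrite (_ : (fun k => scons 0 e k) = scons 0 e) // mk => hr.
split => [/hr|[x Px]].
  by case=> x /= hx; exists x; apply/(h _ N.+1) => //; rewrite mk.
by apply/hr; exists x => /=; rewrite -mk; apply/h.
Qed.

End Definable.

(** * Semi-algebraic functions, quantification over vectors, breakpoints of slices *)

Section DefinableFunctions.
Variable R : rcfType.
Notation env := (nat -> R).

Lemma sa_ex (Q : R -> env -> Prop) :
  sa (fun e => Q (e 0%N) (fun k => e k.+1)) -> sa (fun e => exists x, Q x e).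
Proof. exact: sa_ex_scons. Qed.

Lemma sa_all (Q : R -> env -> Prop) :
  sa (fun e => Q (e 0%N) (fun k => e k.+1)) -> sa (fun e => forall x, Q x e).
Proof.
move=> hQ; apply: (@sa_iff _ (fun e => ~ exists x, ~ Q x e)).
  move=> e; split=> [h x|h [x]]; last by apply.
  by apply: NNPP => hx; apply: h; exists x.
by apply/sa_not/sa_ex/sa_not.
Qed.

Lemma sa_ren (s : nat -> nat) (P : env -> Prop) : sa P ->
  sa (fun e => P (fun k => e (s k))).
Proof. by apply: sa_subst => k; apply: pfun_var. Qed.

(** A function is semi-algebraic when its graph is; index [0] holds the value and the arguments are
    shifted by one. *)
Definition df (F : env -> R) := sa (fun e => e 0%N = F (fun k => e k.+1)).

Lemma df_ren (s : nat -> nat) (F : env -> R) : df F -> df (fun e => F (fun k => e (s k))).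
Proof. by move=> /(sa_ren (fun k => if k is k'.+1 then (s k').+1 else 0%N)). Qed.

Lemma df_pfun F : pfun F -> df F.
Proof.
move=> hF; apply: (@sa_iff _ (fun e => e 0%N - F (fun k => e k.+1) = 0)).
  by move=> e; split=> [/eqP|->]; rewrite ?subrr // subr_eq0 => /eqP.
apply: sa_eq0; apply: pfunB; first exact: pfun_var.
by apply: pfun_subst hF => k; apply: pfun_var.
Qed.

Lemma df_var k : df (fun e => e k). Proof. exact/df_pfun/pfun_var. Qed.
Lemma df_cst c : df (fun=> c). Proof. exact/df_pfun/pfun_cst. Qed.

Lemma sa_df1 (P : R -> Prop) F : df F -> sa (fun e => P (e 0%N)) -> sa (fun e => P (F e)).
Proof.
move=> hF hP; apply: (@sa_iff _ (fun e => exists a, a = F e /\ P a)).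
  by move=> e; split=> [[a [-> //]]|h]; exists (F e).
by apply: sa_ex; apply: sa_and.
Qed.

Lemma sa_df2 (P : R -> R -> Prop) F G : df F -> df G ->
  sa (fun e => P (e 0%N) (e 1%N)) -> sa (fun e => P (F e) (G e)).
Proof.
move=> hF hG hP; apply: (@sa_iff _ (fun e => exists a, exists b, (a = F e /\ b = G e) /\ P a b)).
  by move=> e; split=> [[a [b [[-> ->] //]]]|h]; exists (F e), (G e).
apply/sa_ex/sa_ex; apply: sa_and; first apply: sa_and.
- exact: (sa_ren S hF).
- by have := sa_ren (fun k => if k is k'.+1 then k'.+2 else 0%N) hG.
- exact: (sa_ren (fun k => if k is k'.+1 then 0%N else 1%N) hP).
Qed.

Lemma sa_lt F G : df F -> df G -> sa (fun e => F e < G e).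
Proof.
move=> hF hG; apply: (@sa_df2 (fun a b => a < b)) => //.
apply: (@sa_iff _ (fun e => 0 < e 1%N - e 0%N)); first by move=> e; rewrite subr_gt0.
by apply/sa_gt0/pfunB; apply: pfun_var.
Qed.

Lemma sa_le F G : df F -> df G -> sa (fun e => F e <= G e).
Proof.
move=> hF hG; apply: (@sa_iff _ (fun e => ~ (G e < F e))).
  by move=> e; rewrite leNgt; split => /negP.
exact/sa_not/sa_lt.
Qed.

Lemma sa_eq F G : df F -> df G -> sa (fun e => F e = G e).
Proof.
move=> hF hG; apply: (@sa_iff _ (fun e => F e <= G e /\ G e <= F e)).
  by move=> e; split=> [[h1 h2]|->] //; apply/eqP; rewrite eq_le h1 h2.
by apply: sa_and; apply: sa_le.
Qed.

Lemma df_fun1 (h : R -> R) F : sa (fun e => e 0%N = h (e 1%N)) -> df F ->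
  df (fun e => h (F e)).
Proof.
move=> hh hF; apply: (@sa_df2 (fun a b => a = h b)) => //; first exact: df_var.
by have := df_ren S hF.
Qed.

Lemma df_fun2 (h : R -> R -> R) F G : sa (fun e => e 0%N = h (e 1%N) (e 2%N)) ->
  df F -> df G -> df (fun e => h (F e) (G e)).
Proof.
move=> hh hF hG.
apply: (@sa_iff _ (fun e => exists a, a = F (fun k => e k.+1) /\ e 0%N = h a (G (fun k => e k.+1)))).
  by move=> e; split=> [[a [-> ->]]|->] //; exists (F (fun k => e k.+1)).
apply: sa_ex; apply: sa_and.
  by have := sa_ren (fun k => if k is k'.+1 then k'.+2 else 0%N) hF.
apply: (@sa_iff _ (fun e => exists b, b = G (fun k => e k.+2) /\ e 1%N = h (e 0%N) b)).
  by move=> e; split=> [[a [-> ->]]|->] //; exists (G (fun k => e k.+2)).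
apply: sa_ex; apply: sa_and.
  by have := sa_ren (fun k => if k is k'.+1 then k'.+3 else 0%N) hG.
by have := sa_ren (fun k => if k is k'.+1 then (if k' is 0 then 1 else 0)%N else 2%N) hh.
Qed.

Lemma dfD F G : df F -> df G -> df (fun e => F e + G e).
Proof.
apply: (@df_fun2 (fun a b => a + b)); apply: sa_eq; first exact: df_var.
by apply: df_pfun; apply: pfunD; apply: pfun_var.
Qed.

Lemma dfM F G : df F -> df G -> df (fun e => F e * G e).
Proof.
apply: (@df_fun2 (fun a b => a * b)); apply: sa_eq; first exact: df_var.
by apply: df_pfun; apply: pfunM; apply: pfun_var.
Qed.

Lemma dfN F : df F -> df (fun e => - F e).
Proof.
apply: (@df_fun1 (fun a => - a)); apply: sa_eq; first exact: df_var.
by apply: df_pfun; apply: pfunN; apply: pfun_var.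
Qed.

Lemma dfX F k : df F -> df (fun e => F e ^+ k).
Proof.
apply: (@df_fun1 (fun a => a ^+ k)); apply: sa_eq; first exact: df_var.
by apply: df_pfun; apply: pfunX; apply: pfun_var.
Qed.

Lemma df_max F G : df F -> df G -> df (fun e => Num.max (F e) (G e)).
Proof.
apply: (@df_fun2 Num.max).
apply: (@sa_iff _ (fun e => (e 1%N <= e 2%N /\ e 0%N = e 2%N) \/ (e 2%N <= e 1%N /\ e 0%N = e 1%N))).
  move=> e; split; first by case=> -[h ->]; rewrite ?(max_r h) ?(max_l h).
  by move=> ->; case: (leP (e 1%N) (e 2%N)) => h; [left|right; rewrite ltW].
by apply: sa_or; (apply: sa_and; [apply: sa_le|apply: sa_eq]); exact: df_var.
Qed.

Lemma df_inv F : df F -> df (fun e => (F e)^-1).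
Proof.
apply: (@df_fun1 GRing.inv).
apply: (@sa_iff _ (fun e => (e 1%N = 0 /\ e 0%N = 0) \/ (~ (e 1%N = 0) /\ e 0%N * e 1%N = 1))).
  move=> e; split.
    case=> [[-> ->]|[/eqP h0 h1]]; first by rewrite invr0.
    by apply: (mulIf h0); rewrite mulVf.
  move=> ->; case: (eqVneq (e 1%N) 0) => [->|h]; first by left; rewrite invr0.
  by right; split; [apply/eqP|rewrite mulVf].
apply: sa_or; apply: sa_and; try apply: sa_not; apply: sa_eq; try exact: df_var;
  try exact: df_cst; by apply: dfM; exact: df_var.
Qed.

Lemma df_sum I (s : seq I) (P : pred I) (F : I -> env -> R) :
  (forall i, df (F i)) -> df (fun e => \sum_(i <- s | P i) F i e).
Proof.
move=> hF; elim: s => [|i s IH].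
  rewrite (_ : (fun _ => _) = fun=> 0); first exact: df_cst.
  by apply: functional_extensionality => e; rewrite big_nil.
case Pi: (P i).
  rewrite (_ : (fun _ => _) = fun e => F i e + \sum_(i <- s | P i) F i e).
    exact: dfD.
  by apply: functional_extensionality => e; rewrite big_cons Pi.
rewrite (_ : (fun _ => _) = fun e => \sum_(i <- s | P i) F i e) //.
by apply: functional_extensionality => e; rewrite big_cons Pi.
Qed.

Lemma sa_const (P : Prop) : sa (fun _ : env => P).
Proof.
case: (classic P) => h.
  by apply: sa_iff (sa_bool _ true) => e; split.
by apply: sa_iff (sa_bool _ false) => e; split.
Qed.

Lemma sa_fin_all (I : finType) (P : I -> env -> Prop) :
  (forall i, sa (P i)) -> sa (fun e => forall i, P i e).
Proof.
move=> hP; have H (s : seq I) : sa (fun e => forall i, i \in s -> P i e).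
  elim: s => [|i s IH]; first by apply: (sa_iff _ (sa_const True)) => e; split.
  apply: (sa_iff _ (sa_and (hP i) IH)) => e; split.
    by move=> [h1 h2] j; rewrite inE => /orP[/eqP->|/h2].
  by move=> h; split=> [|j js]; apply: h; rewrite inE ?eqxx // js orbT.
by apply: (sa_iff _ (H (enum I))) => e; split=> h i; [apply: h; rewrite mem_enum|].
Qed.

Definition vcat n (y : 'I_n -> R) (e : env) : env :=
  fun k => if insub k is Some i then y i else e (k - n)%N.

Lemma vcatL n (y : 'I_n -> R) e (i : 'I_n) : vcat y e i = y i.
Proof. by rewrite /vcat; case: insubP => [u _ /val_inj ->|]; rewrite ?ltn_ord. Qed.

Lemma vcatR n (y : 'I_n -> R) e k : vcat y e (n + k) = e k.
Proof.
rewrite /vcat; case: insubP => [u _ /= uE|_]; last by rewrite addKn.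
by have := ltn_ord u; rewrite uE -ltn_subRL subnn.
Qed.

Lemma vcatS n (y : 'I_n.+1 -> R) e :
  vcat y e = scons (y ord0) (vcat (fun i => y (lift ord0 i)) e).
Proof.
apply: functional_extensionality => -[|k] /=.
  by have := vcatL y e ord0.
rewrite /vcat; case: insubP => [u hu /= uE|h]; case: insubP => [v hv /= vE|h'].
- by congr y; apply: val_inj; rewrite /= uE -vE.
- by rewrite -ltnS hu in h'.
- by rewrite -ltnS (negPf h) in hv.
- by rewrite subSS.
Qed.

Lemma sa_exn_vcat n P : sa P -> sa (fun e => exists y : 'I_n -> R, P (vcat y e)).
Proof.
elim: n P => [|n IH] P hP.
  apply: sa_iff hP => e; have h y : vcat (y : 'I_0 -> R) e = e.
    by apply: functional_extensionality => k; rewrite -[k]add0n vcatR add0n.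
  by split=> [hp|[y]]; [exists (fun=> 0)|]; rewrite h.
apply: (sa_iff _ (IH _ (sa_ex_scons hP))) => e; split.
  move=> [y [x hx]]; exists (fun i => if unlift ord0 i is Some j then y j else x).
  rewrite vcatS unlift_none; congr (P (scons _ (vcat _ _))): hx.
  by apply: functional_extensionality => i; rewrite liftK.
by move=> [y]; rewrite vcatS => h; exists (fun i => y (lift ord0 i)), (y ord0).
Qed.

Lemma sa_exn n (Q : ('I_n -> R) -> env -> Prop) :
  sa (fun e => Q (fun i => e i) (fun k => e (n + k)%N)) ->
  sa (fun e => exists y, Q y e).
Proof.
move=> /(@sa_exn_vcat n); apply: sa_iff => e.
have h y : (fun i : 'I_n => vcat y e i) = y.
  by apply: functional_extensionality => i; rewrite vcatL.
have h' y : (fun k => vcat (y : 'I_n -> R) e (n + k)) = e.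
  by apply: functional_extensionality => i; rewrite vcatR.
by split=> -[y hy]; exists y; move: hy; rewrite h h'.
Qed.

Lemma sa_alln n (Q : ('I_n -> R) -> env -> Prop) :
  sa (fun e => Q (fun i => e i) (fun k => e (n + k)%N)) ->
  sa (fun e => forall y, Q y e).
Proof.
move=> hQ; apply: (@sa_iff _ (fun e => ~ exists x, ~ Q x e)).
  move=> e; split=> [h x|h [x]]; last by apply.
  by apply: NNPP => hx; apply: h; exists x.
by apply/sa_not/sa_exn/sa_not.
Qed.

(** The size bound [k] depends only on how [F] is built, not on the parameters in [e]; the uniform
    count of breakpoints rests on this. *)
Lemma pfun_poly (F : env -> R) : pfun F -> exists k, forall e, exists p : {poly R},
  (size p <= k)%N /\ forall x, F (scons x e) = p.[x].
Proof.
elim=> [[|j]|c|G H _ [k h] _ [k' h']|G H _ [k h] _ [k' h']].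
- by exists 2%N => e; exists 'X; split=> [|x]; rewrite ?size_polyX ?hornerX.
- by exists 1%N => e; exists (e j)%:P; split=> [|x]; rewrite ?size_polyC ?leq_b1 ?hornerC.
- by exists 1%N => e; exists c%:P; split=> [|x]; rewrite ?size_polyC ?leq_b1 ?hornerC.
- exists (maxn k k') => e; have [p [sp hp]] := h e; have [q [sq hq]] := h' e.
  exists (p + q); split=> [|x]; last by rewrite hornerD hp hq.
  by apply: leq_trans (size_polyD _ _) _; rewrite geq_max !leq_max sp sq orbT.
- exists (k + k')%N => e; have [p [sp hp]] := h e; have [q [sq hq]] := h' e.
  exists (p * q); split=> [|x]; last by rewrite hornerM hp hq.
  apply: leq_trans (size_polyMleq _ _) _; apply: leq_trans (leq_pred _) _.
  exact: leq_add.
Qed.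

(** For an atom the breakpoints are the real roots of the slice polynomial, between which its sign
    is constant; Boolean combinations concatenate the lists. The count [k] is independent of [e], as
    [sa_uniform] requires. *)
Lemma sa_breakpoints P : sa P -> exists k, forall e, exists s : seq R,
  (size s <= k)%N /\ forall x y, x <= y -> (forall z, z \in s -> ~~ (x <= z <= y)) ->
  (P (scons x e) <-> P (scons y e)).
Proof.
elim=> [F /pfun_poly[k h]|Q _ [k h]|Q Q' _ [k h] _ [k' h']|Q Q' QQ' _ [k h]].
- exists k => e; have [p [sp hp]] := h e.
  (* A slice that vanishes identically has constant truth value, hence no breakpoints. *)
  case: (eqVneq p 0) => [p0|p0].
    by exists [::]; split=> // x y _ _; rewrite !hp p0 !horner0.
  pose s := roots p (- cauchy_bound p) (cauchy_bound p).
  exists s; split.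
    apply: leq_trans sp; apply: ltnW; apply: max_poly_roots => //; last exact: uniq_roots.
    by apply/allP => z; exact: root_roots.
  move=> x y xy hs.
  have : {in `[x, y], forall z, ~~ root p z}.
    move=> z; rewrite in_itv /= => zI; apply/negP => pz.
    have : z \in s by rewrite in_roots pz p0 root_in_cauchy_bound.
    by move=> /hs; rewrite zI.
  move=> /polyrN0_itv /(_ x y); rewrite !in_itv /= !lexx xy => /(_ isT isT) hsg.
  by rewrite !hp -(sgr_gt0 p.[y]) hsg sgr_gt0.
- exists k => e; have [s [sp hs]] := h e; exists s; split=> // x y xy /(hs _ _ xy).
  tauto.
- exists (k + k')%N => e; have [s [sp hs]] := h e; have [s' [sp' hs']] := h' e.
  exists (s ++ s'); split; first by rewrite size_cat leq_add.
  move=> x y xy hz.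
  have a : Q (scons x e) <-> Q (scons y e).
    by apply: hs => // z zs; apply: hz; rewrite mem_cat zs.
  have b : Q' (scons x e) <-> Q' (scons y e).
    by apply: hs' => // z zs; apply: hz; rewrite mem_cat zs orbT.
  tauto.
- exists k => e; have [s [sp hs]] := h e; exists s; split=> // x y xy /(hs _ _ xy).
  by rewrite !QQ'.
Qed.

End DefinableFunctions.

(** * Tameness in one variable and compactness *)

Section Tame.
Variable R : rcfType.
Notation env := (nat -> R).

Definition sa1 (P : R -> Prop) := sa (fun e : env => P (e 0%N)).

Lemma sa1_breakpoints P : sa1 P -> exists s : seq R,
  forall x y, x <= y -> (forall z, z \in s -> ~~ (x <= z <= y)) -> (P x <-> P y).
Proof.
by move=> /sa_breakpoints[k /(_ (fun=> 0))[s [_ h]]]; exists s.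
Qed.

(** A real closed field need not be complete, but here the supremum is the least breakpoint that is
    an upper bound of [S]: between it and a point of [S] beyond all breakpoints that are not upper
    bounds, membership is constant. If no breakpoint is an upper bound, [S] contains a half-line. *)
Lemma sa1_sup (S : R -> Prop) : sa1 S -> (exists x, S x) ->
  (exists B, forall x, S x -> x <= B) ->
  exists m, (forall x, S x -> x <= m) /\ (forall b, b < m -> exists2 x, S x & b < x).
Proof.
move=> /sa1_breakpoints[s hs] [x0 Sx0] [B hB].
pose U z := forall x, S x -> x <= z.
have [x' Sx' hx'] : exists2 x', S x' & forall z, z \in s -> ~ U z -> z < x'.
  elim: s {hs} => [|z s [x' Sx' IH]]; first by exists x0.
  case: (classic (U z)) => Uz.
    exists x' => // y; rewrite inE => /orP[/eqP -> //|]; exact: IH.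
  have [x1 Sx1 hx1] : exists2 x1, S x1 & z < x1.
    apply: NNPP => h; apply: Uz => x Sx; rewrite leNgt; apply/negP => zx.
    by apply: h; exists x.
  exists (Num.max x' x1); first by case: leP.
  move=> y; rewrite inE lt_max => /orP[/eqP -> _|ys yU]; first by rewrite hx1 orbT.
  by rewrite IH.
have [[z1 z1s [Uz1 hz1]]|noU] : (exists2 z1, z1 \in s & U z1 /\ forall z, z \in s -> U z -> z1 <= z) \/
    (forall z, z \in s -> ~ U z).
  elim: s {hs hx'} => [|z s IH]; first by right.
  case: (classic (U z)) => Uz; last first.
    case: IH => [[z1 z1s [Uz1 h]]|h].
      left; exists z1; rewrite ?inE ?z1s ?orbT //; split=> // y.
      by rewrite inE => /orP[/eqP -> //|]; apply: h.
    by right=> y; rewrite inE => /orP[/eqP -> //|]; apply: h.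
  left; case: IH => [[z1 z1s [Uz1 h]]|h]; last first.
    exists z; rewrite ?inE ?eqxx //; split=> // y.
    by rewrite inE => /orP[/eqP -> //|/h].
  exists (Num.min z z1).
    by case: leP => _; rewrite inE ?eqxx ?z1s ?orbT.
  split; first by case: leP.
  move=> y; rewrite inE => /orP[/eqP -> _|ys yU]; first by rewrite ge_min lexx.
  by rewrite ge_min h ?orbT.
- exists z1; split=> // b bz1; apply: NNPP => hb.
  have Ub : U b by move=> x Sx; rewrite leNgt; apply/negP => bx; apply: hb; exists x.
  have x'b := Ub _ Sx'.
  have Sy : S ((b + z1) / 2%:R).
    apply/(hs x' _) => //; first by lra.
    move=> z zs; apply/negP => /andP[h1 h2].
    case: (classic (U z)) => [/(hz1 _ zs)|/(hx' _ zs)]; lra.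
  by have := Ub _ Sy; lra.
- have x'B := hB _ Sx'.
  suff /hB : S (B + 1) by lra.
  apply/(hs x' _) => //; first lra.
  by move=> z zs; apply/negP => /andP[h1 h2]; have := hx' _ zs (noU _ zs); lra.
Qed.

Lemma sa1_inf (S : R -> Prop) : sa1 S -> (exists x, S x) ->
  (exists B, forall x, S x -> B <= x) ->
  exists m, (forall x, S x -> m <= x) /\ (forall b, m < b -> exists2 x, S x & x < b).
Proof.
move=> hS [x0 Sx0] [B hB]; have [||| m [h1 h2]] := @sa1_sup (fun x => S (- x)).
- by apply: (sa_df1 _ hS); apply/dfN/df_var.
- by exists (- x0); rewrite opprK.
- by exists (- B) => x /hB; lra.
exists (- m); split=> [x Sx|b mb]; first by have := h1 (- x); rewrite opprK => /(_ Sx); lra.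
by have [|x Sx bx] := h2 (- b); [lra|exists (- x) => //; lra].
Qed.

Definition eventually (a : R) (P : R -> Prop) :=
  exists2 eta, 0 < eta & forall x, a < x -> x < a + eta -> P x.

Lemma seq_gap (s : seq R) a : exists2 eta, 0 < eta & forall z, z \in s -> a < z -> a + eta < z.
Proof.
elim: s => [|z s [eta h0 h]]; first by exists 1.
case: (leP z a) => za.
  exists eta => // y; rewrite inE => /orP[/eqP ->|/h //]; lra.
exists (Num.min eta ((z - a) / 2%:R)); first by rewrite lt_min h0 /=; lra.
move=> y; rewrite inE => /orP[/eqP -> _|/h h1 /h1].
  have : Num.min eta ((z - a) / 2%:R) <= (z - a) / 2%:R by rewrite ge_min lexx orbT.
  lra.
have : Num.min eta ((z - a) / 2%:R) <= eta by rewrite ge_min lexx.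
lra.
Qed.

(** A small interval on the right of [a] contains no breakpoint, so the truth value is constant on
    it. *)
Lemma eventually_dec a P : sa1 P -> eventually a P \/ eventually a (fun x => ~ P x).
Proof.
move=> /sa1_breakpoints[s hs]; have [eta h0 h] := seq_gap s a.
have aux x y : a < x -> x <= y -> y < a + eta -> P x <-> P y.
  move=> ax xy ye; apply: hs => // z zs; apply/negP => /andP[xz zy].
  by have := h z zs; lra.
have hm : P (a + eta / 2%:R) -> eventually a P.
  move=> Pm; exists (eta / 2%:R); first lra.
  by move=> x ax xe; apply/(aux x (a + eta / 2%:R)) => //; lra.
case: (classic (P (a + eta / 2%:R))) => [/hm|Pm]; first by left.
right; exists (eta / 2%:R); first lra.
by move=> x ax xe Px; apply/Pm/(aux x) => //; lra.
Qed.

Lemma eventually_and a P Q : eventually a P -> eventually a Q -> eventually a (fun x => P x /\ Q x).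
Proof.
move=> [e1 h1 H1] [e2 h2 H2]; exists (Num.min e1 e2); first by rewrite lt_min h1.
have l1 : Num.min e1 e2 <= e1 by rewrite ge_min lexx.
have l2 : Num.min e1 e2 <= e2 by rewrite ge_min lexx orbT.
by move=> x ax xe; split; [apply: H1|apply: H2] => //; lra.
Qed.

Lemma eventually_fin_all (I : finType) a (P : I -> R -> Prop) :
  (forall i, eventually a (P i)) -> eventually a (fun x => forall i, P i x).
Proof.
move=> hP; have [e he H] : eventually a (fun x => forall i, i \in enum I -> P i x).
  elim: (enum I) => [|i s IH]; first by exists 1.
  have [e he H] := eventually_and (hP i) IH; exists e => // x ax xe j.
  by have [h1 h2] := H x ax xe; rewrite inE => /orP[/eqP ->|/h2].
by exists e => // x ax xe i; apply: H; rewrite ?mem_enum.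
Qed.

Lemma eventually_wit a P : eventually a P -> forall eta, 0 < eta ->
  exists x, [/\ a < x, x < a + eta & P x].
Proof.
move=> [e he H] eta h; pose m := Num.min e eta.
have m0 : 0 < m by rewrite lt_min he.
have l1 : m <= e by rewrite ge_min lexx.
have l2 : m <= eta by rewrite ge_min lexx orbT.
by exists (a + m / 2%:R); split; [lra|lra|apply: H; lra].
Qed.

(** By the dichotomy, if no [P i] held eventually, all of them would fail eventually, against their
    occurring arbitrarily close to [a]. *)
Lemma eventually_pigeonhole (I : finType) a (P : I -> R -> Prop) :
  (forall i, sa1 (P i)) ->
  (forall eta, 0 < eta -> exists x, [/\ a < x, x < a + eta & exists i, P i x]) ->
  exists i, eventually a (P i).
Proof.
move=> hP hx; apply: NNPP => no.
have [e he H] : eventually a (fun x => forall i, ~ P i x).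
  apply: eventually_fin_all => i; case: (eventually_dec a (hP i)) => // h.
  by case: no; exists i.
by have [x [ax xe [i Pi]]] := hx e he; case: (H x ax xe i).
Qed.

(* At most [k] points are breakpoints of a given slice, so one of [k + 1] sample
   points is interior to the slice at the smallest of their radii. *)
Lemma sa_uniform (P : R -> R -> Prop) a b : sa (fun e : env => P (e 1%N) (e 0%N)) ->
  (forall d d' v, d' <= d -> P d v -> P d' v) -> a < b ->
  (forall v, a < v -> v < b -> exists2 d, 0 < d & P d v) ->
  exists d a' b', [/\ 0 < d, a <= a', a' < b', b' <= b &
    forall v, a' < v -> v < b' -> P d v].
Proof.
move=> hP Pmono ab hv; have [k hk] := sa_breakpoints hP.
pose v (j : 'I_k.+1) := a + (b - a) * j.+1%:R / k.+2%:R.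
have v_in j : a < v j < b.
  have k0 : 0 < k.+2%:R :> R by rewrite ltr0n.
  have j1 : 0 < (j.+1%:R / k.+2%:R : R) by rewrite divr_gt0 ?ltr0n.
  have j2 : (j.+1%:R / k.+2%:R : R) < 1 by rewrite ltr_pdivrMr // mul1r ltr_nat ltnS.
  have ba : 0 < b - a by rewrite subr_gt0.
  have h1 := mulr_gt0 ba j1.
  have h2 : (b - a) * (j.+1%:R / k.+2%:R) < b - a by rewrite gtr_pMr.
  by rewrite /v -mulrA ltrDl h1 /= -ltrBrDl.
have v_inj : injective v.
  move=> i j /addrI; rewrite -!mulrA => /mulfI.
  rewrite subr_eq0 gt_eqF // => /(_ isT) /mulIf.
  rewrite invr_eq0 pnatr_eq0 => /(_ isT) /eqP; rewrite eqr_nat eqSS => /eqP.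
  exact: val_inj.
have [d d0 hd] : exists2 d, 0 < d & forall j, P d (v j).
  have [d d0 hd] : exists2 d, 0 < d & forall j, j \in enum 'I_k.+1 -> P d (v j).
    elim: (enum _) => [|j s [d d0 hd]]; first by exists 1.
    have /andP[h1 h2] := v_in j; have [d' d'0 hd'] := hv _ h1 h2.
    exists (Num.min d d'); first by rewrite lt_min d0.
    move=> i; rewrite inE => /orP[/eqP ->|/hd].
      by apply: Pmono hd'; rewrite ge_min lexx orbT.
    by apply: Pmono; rewrite ge_min lexx.
  by exists d => // j; apply: hd; rewrite mem_enum.
have [s [ss hs]] := hk (fun=> d).
have [j hj] : exists j, v j \notin s.
  apply: NNPP => no; suff : (k.+1 <= size s)%N by rewrite leqNgt ltnS ss.
  rewrite -(size_enum_ord k.+1) -(size_map v); apply: uniq_leq_size.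
    by rewrite map_inj_uniq // enum_uniq.
  move=> z /mapP[j _ ->]; apply/negPn/negP => h; by apply: no; exists j.
have [e1 e10 he1] := seq_gap s (v j).
have /andP[h1 h2] := v_in j.
exists d, (v j), (Num.min b (v j + e1)); split=> //; first exact: ltW.
- by rewrite lt_min h2; lra.
- by rewrite ge_min lexx.
move=> x vx; rewrite lt_min => /andP[xb xe].
apply: (proj1 (hs (v j) x (ltW vx) _)); last exact: hd.
move=> z zs; apply/negP => /andP[vz zx].
have : v j < z by rewrite lt_neqAle vz andbT; apply: contraNneq hj => ->.
by move=> /(he1 _ zs); lra.
Qed.

(** * Compactness of closed bounded semi-algebraic sets *)

Definition saS n (A : ('I_n -> R) -> Prop) := sa (fun e : env => A (fun i => e i)).

Definition near n (p y : 'I_n -> R) (d : R) := forall i, `|y i - p i| < d.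

Definition closedS n (A : ('I_n -> R) -> Prop) :=
  forall p, (forall d, 0 < d -> exists2 y, A y & near p y d) -> A p.

Definition boundedS n (A : ('I_n -> R) -> Prop) (B : R) :=
  forall y, A y -> forall i, `|y i| <= B.

(** The limit superior of coordinate [k] along the shrinking family [Z d]; it exists by
    [sa1_sup]. *)
Lemma cluster_coord n (Z : R -> ('I_n -> R) -> Prop) B k :
  sa (fun e : env => Z (e n) (fun i => e i)) ->
  (forall d, 0 < d -> exists y, Z d y) ->
  (forall d d' y, 0 < d' -> d' <= d -> Z d' y -> Z d y) ->
  (forall d y, Z d y -> forall i, `|y i| <= B) ->
  exists a, forall d, 0 < d -> exists2 y, Z d y & `|y k - a| < d.
Proof.
move=> hZ Zne Zmono Zb.
pose S a := forall d, 0 < d -> exists y, Z d y /\ a <= y k.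
have [|||a [ha1 ha2]] := @sa1_sup S.
- apply: sa_all; apply: sa_imp; first by apply: sa_lt; [apply: df_cst|apply: df_var].
  apply: sa_exn; apply: sa_and.
    have := sa_ren (fun k => if (k <= n)%N then k else 0%N) hZ.
    apply: sa_iff => e; rewrite leqnn addn0 (_ : (fun i : 'I_n => _) = fun i => e i) //.
    by apply: functional_extensionality => i; rewrite ltnW.
  by apply: sa_le; [apply: df_var|apply: df_var].
- exists (- B) => d d0; have [y Zy] := Zne d d0; exists y; split=> //.
  by have := Zb _ _ Zy k; rewrite ler_norml => /andP[].
- exists B => a /(_ 1 ltr01)[y [Zy ay]]; apply: le_trans ay _.
  by have := Zb _ _ Zy k; rewrite ler_norml => /andP[].
exists a => d d0.
have [d1 d10 hd1] : exists2 d1, 0 < d1 & forall y, Z d1 y -> y k < a + d.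
  apply: NNPP => no.
  have /ha1 : S (a + d); last by lra.
  move=> d1 d10; apply: NNPP => no'; apply: no; exists d1 => // y Zy.
  by rewrite ltNge; apply/negP => h; apply: no'; exists y.
have [|x Sx xa] := ha2 (a - d); first lra.
have m0 : 0 < Num.min d d1 by rewrite lt_min d0.
have [y [Zy xy]] := Sx _ m0; exists y.
  by apply: Zmono Zy => //; rewrite ge_min lexx.
have : Z d1 y by apply: Zmono Zy => //; rewrite ge_min lexx orbT.
by move=> /hd1 h; rewrite ltr_norml; lra.
Qed.

(** A Bolzano-Weierstrass principle for definable shrinking families, replacing bounded sequences,
    which need not have cluster points over [R]. Coordinates are fixed one at a time. *)
Lemma cluster n (Z : R -> ('I_n -> R) -> Prop) B :
  sa (fun e : env => Z (e n) (fun i => e i)) ->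
  (forall d, 0 < d -> exists y, Z d y) ->
  (forall d d' y, 0 < d' -> d' <= d -> Z d' y -> Z d y) ->
  (forall d y, Z d y -> forall i, `|y i| <= B) ->
  exists p, forall d, 0 < d -> exists2 y, Z d y & near p y d.
Proof.
move=> hZ Zne Zmono Zb.
suff H k : exists p : 'I_n -> R, forall d, 0 < d ->
    exists2 y, Z d y & forall i : 'I_n, (i < k)%N -> `|y i - p i| < d.
  by have [p hp] := H n; exists p => d /hp[y Zy h]; exists y => // i; apply: h.
elim: k => [|k [p hp]]; first by exists (fun=> 0) => d /Zne[y Zy]; exists y.
case: (ltnP k n) => kn; last first.
  exists p => d /hp[y Zy h]; exists y => // i _; apply: h.
  exact: leq_trans (ltn_ord i) kn.
pose Z' d y := Z d y /\ forall i : 'I_n, (i < k)%N -> `|y i - p i| < d.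
have [||||a ha] := @cluster_coord n Z' B (Ordinal kn).
- apply: sa_and => //; apply: sa_fin_all => i; apply: sa_imp; first exact: sa_const.
  apply: (@sa_iff _ (fun e => e i - p i < e n /\ - e n < e i - p i)).
    by move=> e; rewrite ltr_norml; split=> [[-> ->]|/andP[-> ->]].
  apply: sa_and; apply: sa_lt; do ?[exact: df_var|apply: dfN|apply: dfD|exact: df_cst].
- by move=> d d0; have [y Zy h] := hp d d0; exists y.
- move=> d d' y d'0 dd' [h1 h2]; split; first exact: Zmono h1.
  by move=> i ik; apply: lt_le_trans (h2 i ik) dd'.
- by move=> d y [/Zb].
exists (fun i => if i == Ordinal kn then a else p i) => d /ha[y [Zy h] ya].
exists y => // i; rewrite ltnS leq_eqVlt => /orP[/eqP ik|ik].
  have -> : i = Ordinal kn by apply: val_inj.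
  by rewrite eqxx.
rewrite ifN ?h //; apply: contraTneq ik => ->; by rewrite /= ltnn.
Qed.

Definition cont_at n (F : ('I_n -> R) -> R) p :=
  forall e, 0 < e -> exists2 d, 0 < d & forall y, near p y d -> `|F y - F p| < e.

(** The infimum [m] exists by [sa1_inf]; a cluster point of the sets where [F < m + d] lies in [A]
    by closedness, and continuity bounds its value by [m]. *)
Lemma extreme_value n (A : ('I_n -> R) -> Prop) (F : ('I_n -> R) -> R) B :
  saS A -> df (fun e => F (fun i => e i)) -> closedS A -> boundedS A B ->
  (forall p, A p -> cont_at F p) -> (exists y, A y) ->
  (exists c, forall y, A y -> c <= F y) ->
  exists2 p, A p & forall y, A y -> F p <= F y.
Proof.
move=> hA hF Acl Ab Fc [y0 Ay0] [c hc].
have [|||m [hm1 hm2]] := @sa1_inf (fun t => exists y, A y /\ t = F y).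
- apply: sa_exn; apply: sa_and => //.
  apply: sa_eq; first exact: df_var.
  exact: hF.
- by exists (F y0), y0.
- by exists c => x [y [Ay ->]]; apply: hc.
have [||||p hp] := @cluster n (fun d y => A y /\ F y < m + d) B.
- apply: sa_and => //; apply: sa_lt => //; apply: dfD; [exact: df_cst|exact: df_var].
- move=> d d0; have [|x [y [Ay ->]] h] := hm2 (m + d); first lra.
  by exists y.
- by move=> d d' y d'0 dd' [Ay h]; split=> //; lra.
- by move=> d y [/Ab].
have Ap : A p by apply: Acl => d /hp[y [Ay _] h]; exists y.
exists p => // y Ay; apply: (@le_trans _ _ m); last by apply: hm1; exists y.
rewrite leNgt; apply/negP => mF.
have [|d d0 hd] := Fc p Ap ((F p - m) / 2%:R); first lra.
have d'0 : 0 < Num.min d ((F p - m) / 2%:R) by rewrite lt_min d0 /=; lra.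
have [z [Az Fz] nz] := hp _ d'0.
have l1 : Num.min d ((F p - m) / 2%:R) <= d by rewrite ge_min lexx.
have l2 : Num.min d ((F p - m) / 2%:R) <= (F p - m) / 2%:R by rewrite ge_min lexx orbT.
have := hd z (fun i => lt_le_trans (nz i) l1).
by rewrite ltr_norml => /andP[h1 h2]; lra.
Qed.

End Tame.

(** * Taylor expansions and continuity *)

Section Taylor.
Variables (R : rcfType) (n : nat).
Implicit Types (f : {mpoly R[n]}) (p y : 'I_n -> R).

Lemma pfun_meval f (F : 'I_n -> (nat -> R) -> R) : (forall i, pfun (F i)) ->
  pfun (fun e => f.@[fun i => F i e]).
Proof.
move=> hF; rewrite (_ : (fun _ => _) = fun e =>
  \sum_(m <- msupp f) f@_m * \prod_i F i e ^+ m i).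
  by apply: pfun_sum => m; apply: pfunM; [apply: pfun_cst|apply: pfun_prod => i; apply: pfunX].
by apply: functional_extensionality => e; rewrite mevalE.
Qed.

Definition taylor_rem f y y' := f.@[y'] - f.@[y] - \sum_i (f^`M(i)).@[y] * (y' i - y i).

(** A first-order Taylor estimate on a box with a single constant. The bounds on the value and on
    the increment are carried along because products need them. *)
Definition taylor (B : R) f := exists2 C, 0 <= C & forall y y' m,
  (forall i, `|y i| <= B) -> (forall i, `|y' i| <= B) -> 0 <= m ->
  (forall i, `|y' i - y i| <= m) ->
  [/\ `|f.@[y]| <= C, `|f.@[y'] - f.@[y]| <= C * m & `|taylor_rem f y y'| <= C * m ^+ 2].

Lemma taylorC B c : taylor B c%:MP.
Proof.
exists `|c| => // y y' m _ _ m0 _; rewrite /taylor_rem !mevalC subrr !normr0 big1.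
  by rewrite subr0 normr0 !mulr_ge0 // exprn_ge0.
by move=> i _; rewrite mderivC meval0 mul0r.
Qed.

Lemma taylorX B i : 0 <= B -> taylor B 'X_i.
Proof.
move=> B0; exists (B + 1); first lra.
move=> y y' m hy hy' m0 hm.
rewrite /taylor_rem !mevalXU (bigD1 i) //= mderivX mnm1E eqxx scale1r.
have -> : (U_(i) - U_(i))%MM = 0%MM :> 'X_{1..n} by apply/mnmP => j; rewrite mnmBE subnn mnm0E.
rewrite mpolyX0 meval1 mul1r.
rewrite big1 => [|j ji].
  rewrite addr0 subrr normr0; split; last by rewrite mulr_ge0 ?exprn_ge0 //; lra.
    by have := hy i; lra.
  by apply: le_trans (hm i) _; nra.
by rewrite mderivX mnm1E eq_sym (negPf ji) scale0r meval0 mul0r.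
Qed.

Lemma taylorD B f g : taylor B f -> taylor B g -> taylor B (f + g).
Proof.
move=> [C C0 hC] [D D0 hD]; exists (C + D); first exact: addr_ge0.
move=> y y' m hy hy' m0 hm.
have [a1 a2 a3] := hC y y' m hy hy' m0 hm; have [b1 b2 b3] := hD y y' m hy hy' m0 hm.
have -> : taylor_rem (f + g) y y' = taylor_rem f y y' + taylor_rem g y y'.
  rewrite /taylor_rem; under eq_bigr do rewrite mderivD mevalD mulrDl.
  by rewrite big_split !mevalD /=; ring.
rewrite !mevalD; split.
- exact: le_trans (ler_normD _ _) (lerD a1 b1).
- rewrite mulrDl opprD addrACA; exact: le_trans (ler_normD _ _) (lerD a2 b2).
- rewrite mulrDl; exact: le_trans (ler_normD _ _) (lerD a3 b3).
Qed.

(** The remainder of a product splits into three pieces, each at most [C * D * m ^+ 2]; hence the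
    factor [3]. *)
Lemma taylorM B f g : taylor B f -> taylor B g -> taylor B (f * g).
Proof.
move=> [C C0 hC] [D D0 hD]; exists (3%:R * C * D); first by rewrite !mulr_ge0.
move=> y y' m hy hy' m0 hm.
have CD := mulr_ge0 C0 D0.
have [a1 a2 a3] := hC y y' m hy hy' m0 hm; have [b1 b2 b3] := hD y y' m hy hy' m0 hm.
have [a1' _ _] := hC y' y m hy' hy m0 (fun i => ltac:(rewrite distrC; exact: hm)).
have -> : taylor_rem (f * g) y y' = (f.@[y'] - f.@[y]) * (g.@[y'] - g.@[y]) +
    f.@[y] * taylor_rem g y y' + g.@[y] * taylor_rem f y y'.
  rewrite /taylor_rem; under eq_bigr do rewrite mderivM mevalD !mevalM mulrDl.
  rewrite big_split /= !mevalM.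
  have -> : \sum_i (f^`M(i)).@[y] * g.@[y] * (y' i - y i) =
     g.@[y] * (\sum_i (f^`M(i)).@[y] * (y' i - y i)).
    by rewrite mulr_sumr; apply: eq_bigr => i _; ring.
  have -> : \sum_i f.@[y] * (g^`M(i)).@[y] * (y' i - y i) =
     f.@[y] * (\sum_i (g^`M(i)).@[y] * (y' i - y i)).
    by rewrite mulr_sumr; apply: eq_bigr => i _; ring.
  ring.
have mul2 (a b c d : R) : `|a| <= c -> `|b| <= d -> `|a * b| <= c * d.
  by move=> h1 h2; rewrite normrM; apply: ler_pM.
rewrite !mevalM; split.
- apply: le_trans (mul2 _ _ _ _ a1 b1) _; lra.
- have -> : f.@[y'] * g.@[y'] - f.@[y] * g.@[y] =
    f.@[y'] * (g.@[y'] - g.@[y]) + g.@[y] * (f.@[y'] - f.@[y]) by ring.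
  apply: le_trans (ler_normD _ _) _.
  apply: le_trans (lerD (mul2 _ _ _ _ a1' b2) (mul2 _ _ _ _ b1 a2)) _.
  by have := mulr_ge0 CD m0; lra.
- apply: le_trans (ler_normD _ _) _; apply: le_trans (lerD (ler_normD _ _) (lexx _)) _.
  apply: le_trans (lerD (lerD (mul2 _ _ _ _ a2 b2) (mul2 _ _ _ _ a1 b3))
    (mul2 _ _ _ _ b1 a3)) _.
  by rewrite le_eqVlt; apply/orP; left; apply/eqP; ring.
Qed.

Lemma taylor_mpoly B f : 0 <= B -> taylor B f.
Proof.
move=> B0; elim/mpolyind: f => [|c m p _ _ IH]; first by rewrite -mpolyC0; exact: taylorC.
apply: taylorD => //; rewrite -mul_mpolyC; apply: taylorM; first exact: taylorC.
rewrite mpolyXE_id; elim/big_rec: _ => [|i g _ IHg]; first by rewrite -mpolyC1; exact: taylorC.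
apply: taylorM => //; elim: (m i) => [|k IHk]; first by rewrite expr0 -mpolyC1; exact: taylorC.
by rewrite exprS; apply: taylorM => //; exact: taylorX.
Qed.

Lemma box_of p : exists2 B, 0 <= B & forall i, `|p i| <= B.
Proof.
exists (\sum_i `|p i|); first exact: sumr_ge0.
by move=> i; rewrite (bigD1 i) //= lerDl sumr_ge0.
Qed.

Lemma near_box B p y d : (forall i, `|p i| <= B) -> near p y d -> d <= 1 ->
  forall i, `|y i| <= B + 1.
Proof.
move=> hp hy d1 i; have -> : y i = p i + (y i - p i) by ring.
apply: le_trans (ler_normD _ _) _; apply: lerD => //.
exact: le_trans (ltW (hy i)) d1.
Qed.

Lemma cont_meval f p : cont_at (fun y => f.@[y]) p.
Proof.
move=> e e0; have [B B0 hB] := box_of p.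
have B1 : 0 <= B + 1 by lra.
have [C C0 hC] := taylor_mpoly f B1.
have q0 : 0 < e / (C + 1) by rewrite divr_gt0 //; lra.
exists (Num.min 1 (e / (C + 1))); first by rewrite lt_min ltr01.
set d := Num.min _ _ => y hy.
have d1 : d <= 1 by rewrite ge_min lexx.
have d2 : d <= e / (C + 1) by rewrite ge_min lexx orbT.
have d0 : 0 < d by rewrite lt_min ltr01.
have [|_ h _] := hC p y d _ (near_box hB hy d1) (ltW d0) (fun i => ltW (hy i)).
  by move=> i; apply: le_trans (hB i) _; lra.
apply: le_lt_trans h _.
have : d * (C + 1) <= e by rewrite -ler_pdivlMr //; lra.
by nra.
Qed.

(** A step [t * D] against a nonzero partial derivative [D] lowers [f] by [t * D ^+ 2] up to an
    error [C * t ^+ 2 * D ^+ 2], which is smaller for small [t]. *)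
Lemma local_min_grad f p d : 0 < d -> (forall y, near p y d -> f.@[p] <= f.@[y]) ->
  forall i, (f^`M(i)).@[p] = 0.
Proof.
move=> d0 hmin i; apply/eqP; apply: contraT => D0; set D := (f^`M(i)).@[p] in D0.
have [B B0 hB] := box_of p.
have B1 : 0 <= B + 1 by lra.
have [C C0 hC] := taylor_mpoly f B1.
have nD : 0 < `|D| by rewrite normr_gt0.
(* The first bound makes the quadratic error smaller than the gain; the second keeps the step at
   most [1], hence in the box, and below [d]. *)
pose t := Num.min ((C + 1)^-1) (Num.min 1 (d / 2%:R) / `|D|).
have m0 : 0 < Num.min 1 (d / 2%:R) by rewrite lt_min ltr01 /=; lra.
have t0 : 0 < t.
  by rewrite lt_min invr_gt0 divr_gt0 // andbT; lra.
have tC : t * (C + 1) <= 1.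
  rewrite -ler_pdivlMr ?div1r; last lra.
  by rewrite ge_min lexx.
have tD : t * `|D| <= Num.min 1 (d / 2%:R).
  by rewrite -ler_pdivlMr // ge_min lexx orbT.
have tD1 : t * `|D| <= 1 by apply: le_trans tD _; rewrite ge_min lexx.
have tDd : t * `|D| <= d / 2%:R by apply: le_trans tD _; rewrite ge_min lexx orbT.
pose y j := p j - (if j == i then t * D else 0).
have yp j : `|y j - p j| <= t * `|D|.
  rewrite /y addrAC subrr sub0r normrN; case: ifP => _; last by rewrite normr0 mulr_ge0 ?ltW.
  by rewrite normrM gtr0_norm.
have hy : near p y d by move=> j; apply: le_lt_trans (yp j) _; lra.
have [||||_ _] := hC p y (t * `|D|) => //.
- by move=> j; apply: le_trans (hB j) _; lra.
- move=> j; have -> : y j = p j + (y j - p j) by ring.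
  by apply: le_trans (ler_normD _ _) _; apply: lerD => //; apply: le_trans (yp j) _.
- by rewrite mulr_ge0 ?ltW.
have -> : taylor_rem f p y = f.@[y] - f.@[p] + t * D ^+ 2.
  rewrite /taylor_rem (bigD1 i) //= big1 => [|j ji]; last by rewrite /y (negPf ji) subr0 subrr mulr0.
  by rewrite /y eqxx -/D; ring.
have := hmin y hy; set z := f.@[y] - f.@[p] => hz.
have z0 : 0 <= z by rewrite /z; lra.
rewrite exprMn real_normK ?num_real // => /(le_trans (ler_norm _)).
have D2 : 0 < D ^+ 2 by rewrite exprn_even_gt0.
move=> h; have : t * D ^+ 2 <= C * t ^+ 2 * D ^+ 2 by rewrite -mulrA; lra.
rewrite ler_pM2r // => h2.
have : t * 1 <= t * (C * t) by rewrite mulr1; lra.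
rewrite ler_pM2l // => h3.
by move: tC; lra.
Qed.

End Taylor.

(** * Continuity and closed sets *)

Section Continuity.
Variables (R : rcfType) (n : nat).
Implicit Types (F G : ('I_n -> R) -> R) (p : 'I_n -> R).

Lemma cont_cst c p : cont_at (fun=> c) p.
Proof. by move=> e e0; exists 1 => // y _; rewrite subrr normr0. Qed.

Lemma cont_coord i p : cont_at (fun y => y i) p.
Proof. by move=> e e0; exists e => // y; apply. Qed.

Lemma near_min p y d d' : near p y (Num.min d d') -> near p y d /\ near p y d'.
Proof. by move=> h; split=> i; have := h i; rewrite lt_min => /andP[]. Qed.

Lemma contD F G p : cont_at F p -> cont_at G p -> cont_at (fun y => F y + G y) p.
Proof.
move=> hF hG e e0; have e2 : 0 < e / 2%:R by lra.
have [d d0 h] := hF _ e2; have [d' d'0 h'] := hG _ e2.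
exists (Num.min d d'); first by rewrite lt_min d0.
move=> y /near_min[/h a /h' b]; rewrite opprD addrACA.
by apply: le_lt_trans (ler_normD _ _) _; lra.
Qed.

Lemma contN F p : cont_at F p -> cont_at (fun y => - F y) p.
Proof.
by move=> hF e e0; have [d d0 h] := hF _ e0; exists d => // y /h; rewrite -opprD normrN.
Qed.

Lemma contM F G p : cont_at F p -> cont_at G p -> cont_at (fun y => F y * G y) p.
Proof.
move=> hF hG e e0.
pose K := `|F p| + `|G p| + 1.
have K0 : 0 < K by rewrite /K; have := normr_ge0 (F p); have := normr_ge0 (G p); lra.
pose e' := Num.min 1 (e / (2%:R * K)).
have e'0 : 0 < e' by rewrite lt_min ltr01 divr_gt0 // mulr_gt0.
have e'1 : e' <= 1 by rewrite ge_min lexx.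
have e'2 : e' * (2%:R * K) <= e.
  by rewrite -ler_pdivlMr ?mulr_gt0 // ge_min lexx orbT.
have [d d0 h] := hF _ e'0; have [d' d'0 h'] := hG _ e'0.
exists (Num.min d d'); first by rewrite lt_min d0.
move=> y /near_min[/h a /h' b].
have -> : F y * G y - F p * G p = (F y - F p) * (G y - G p) + F p * (G y - G p) + G p * (F y - F p) by ring.
apply: le_lt_trans (ler_normD _ _) _; rewrite normrM.
apply: le_lt_trans (lerD (ler_normD _ _) (lexx _)) _; rewrite !normrM.
have h1 : `|F y - F p| * `|G y - G p| <= e' * 1.
  by apply: ler_pM => //; [exact: ltW|lra].
have h2 : `|F p| * `|G y - G p| <= `|F p| * e' by apply: ler_wpM2l => //; exact: ltW.
have h3 : `|G p| * `|F y - F p| <= `|G p| * e' by apply: ler_wpM2l => //; exact: ltW.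
have e'K : 0 < e' * K by rewrite mulr_gt0.
have : e' * 1 + `|F p| * e' + `|G p| * e' = e' * K by rewrite /K; ring.
lra.
Qed.

Lemma contX F k p : cont_at F p -> cont_at (fun y => F y ^+ k) p.
Proof.
move=> hF; elim: k => [|k IH]; first exact: cont_cst.
rewrite (_ : (fun _ => _) = fun y => F y * F y ^+ k); first exact: contM.
by apply: functional_extensionality => y; rewrite exprS.
Qed.

Lemma cont_inv F p : F p != 0 -> cont_at F p -> cont_at (fun y => (F y)^-1) p.
Proof.
move=> Fp hF e e0; have a0 : 0 < `|F p| by rewrite normr_gt0.
(* The first bound keeps [F y] away from [0], so that [F y * F p] is at least [|F p|^2 / 2] in
   absolute value; the second then controls the difference of the inverses. *)
pose e' := Num.min (`|F p| / 2%:R) (e * (`|F p| ^+ 2 / 2%:R)).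
have q0 : 0 < `|F p| ^+ 2 / 2%:R by rewrite divr_gt0 // exprn_gt0.
have e'0 : 0 < e' by rewrite lt_min; apply/andP; split; [lra|exact: mulr_gt0].
have e'1 : e' <= `|F p| / 2%:R by rewrite ge_min lexx.
have e'2 : e' <= e * (`|F p| ^+ 2 / 2%:R) by rewrite ge_min lexx orbT.
have [d d0 h] := hF _ e'0; exists d => // y /h hy.
have Fy : `|F p| / 2%:R < `|F y|.
  have : `|F p| <= `|F y| + `|F y - F p|.
    by rewrite (distrC (F y)) -{1}[F p](subrK (F y)) addrC; apply: ler_normD.
  lra.
have Fy0 : F y != 0 by rewrite -normr_gt0; lra.
have -> : (F y)^-1 - (F p)^-1 = (F p - F y) / (F y * F p) by field; rewrite Fy0 Fp.
rewrite normrM normfV normrM ltr_pdivrMr ?mulr_gt0 ?normr_gt0 // distrC.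
apply: lt_le_trans hy _; apply: le_trans e'2 _.
apply: ler_wpM2l; first exact: ltW.
rewrite expr2 -mulrA mulrC; apply: ler_wpM2r; first exact: ltW.
by lra.
Qed.

Lemma cont_max0 F p : cont_at F p -> cont_at (fun y => Num.max (F y) 0) p.
Proof.
move=> hF e e0; have [d d0 h] := hF _ e0; exists d => // y /h; apply: le_lt_trans.
have h1 : F y - F p <= `|F y - F p| := ler_norm _.
have h2 : - (F y - F p) <= `|F y - F p| by rewrite -normrN ler_norm.
have h3 : 0 <= `|F y - F p| := normr_ge0 _.
set t := `|F y - F p| in h1 h2 h3 *.
rewrite ler_norml; case: (lerP (F y) 0) => a; case: (lerP (F p) 0) => b;
  by apply/andP; split; lra.
Qed.

Lemma cont_sum I (s : seq I) (P : pred I) (F : I -> ('I_n -> R) -> R) p :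
  (forall i, cont_at (F i) p) -> cont_at (fun y => \sum_(i <- s | P i) F i y) p.
Proof.
move=> hF; elim: s => [|i s IH].
  rewrite (_ : (fun _ => _) = fun=> 0); first exact: cont_cst.
  by apply: functional_extensionality => e; rewrite big_nil.
case Pi: (P i).
  rewrite (_ : (fun _ => _) = fun e => F i e + \sum_(i <- s | P i) F i e).
    exact: contD.
  by apply: functional_extensionality => e; rewrite big_cons Pi.
rewrite (_ : (fun _ => _) = fun e => \sum_(i <- s | P i) F i e) //.
by apply: functional_extensionality => e; rewrite big_cons Pi.
Qed.

Lemma closed_le F G : (forall p, cont_at F p) -> (forall p, cont_at G p) ->
  closedS (fun y => F y <= G y).
Proof.
move=> hF hG p hp; rewrite leNgt; apply/negP => h.
have [|d d0 hd] := contD (hF p) (contN (hG p)) (e := F p - G p); first lra.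
have [y Fy /hd] := hp d d0; rewrite ltr_norml => /andP[h1 h2]; lra.
Qed.

Lemma closed_and (A B : ('I_n -> R) -> Prop) : closedS A -> closedS B ->
  closedS (fun y => A y /\ B y).
Proof.
by move=> hA hB p hp; split; [apply: hA|apply: hB] => d /hp[y [a b] h]; exists y.
Qed.

Lemma closed_all I (A : I -> ('I_n -> R) -> Prop) : (forall i, closedS (A i)) ->
  closedS (fun y => forall i, A i y).
Proof. by move=> hA p hp i; apply: hA => d /hp[y a h]; exists y. Qed.

End Continuity.

(** * Small values force a relatively large gradient *)

Ltac df_tac := lazymatch goal with
  | |- df (fun e => @?F e + @?G e) => refine (@dfD _ F G _ _); cbv beta; df_tac
  | |- df (fun e => @?F e * @?G e) => refine (@dfM _ F G _ _); cbv beta; df_tac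
  | |- df (fun e => - @?F e) => refine (@dfN _ F _); cbv beta; df_tac
  | |- df (fun e => @?F e ^+ ?k) => refine (@dfX _ F k _); cbv beta; df_tac
  | |- df (fun e => e ?k) => exact: df_var
  | |- df (fun _ => ?c) => exact: df_cst
  | |- _ => idtac
  end.
Ltac sa_tac := lazymatch goal with
  | |- sa (fun e => exists x, @?Q e x) => refine (@sa_ex _ (fun x e => Q e x) _); cbv beta; sa_tac
  | |- sa (fun e => @?P e /\ @?Q e) => refine (@sa_and _ P Q _ _); cbv beta; sa_tac
  | |- sa (fun e => ~ @?P e) => refine (@sa_not _ P _); cbv beta; sa_tac
  | |- sa (fun e => @?P e -> @?Q e) => refine (@sa_imp _ P Q _ _); cbv beta; sa_tac
  | |- sa (fun e => forall x, @?Q e x) => refine (@sa_all _ (fun x e => Q e x) _); cbv beta; sa_tac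
  | |- sa (fun e => is_true (@?P e < @?Q e)) => refine (@sa_lt _ P Q _ _); cbv beta; df_tac
  | |- sa (fun e => is_true (@?P e <= @?Q e)) => refine (@sa_le _ P Q _ _); cbv beta; df_tac
  | |- sa (fun e => @?P e = @?Q e) => refine (@sa_eq _ P Q _ _); cbv beta; df_tac
  | |- _ => idtac
  end.

(** * Semi-algebraic functions of one variable and canonical selection *)

Section OneVariable.
Variable R : rcfType.

Lemma sa_ex2 (P Q : R -> (nat -> R) -> Prop) :
  sa (fun e => exists x, P x e /\ Q x e) -> sa (fun e => exists2 x, P x e & Q x e).
Proof. by apply: sa_iff => e; split=> [[x []]|[x]]; exists x. Qed.

(* Tameness upgrades the one-sided estimate to a two-sided one, hence
   [h (2 v) - h v >= c / 2] for all small [v], against the existence of [inf h]. *)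
Lemma tame_no_blowup (h : R -> R) (c B eta : R) : sa (fun e => e 0%N = h (e 1%N)) ->
  0 < c -> 0 < eta -> (forall v, 0 < v -> v < eta -> `|h v| <= B) ->
  (forall v, 0 < v -> v < eta -> eventually v (fun u => c * (u - v) <= v * (h u - h v))) ->
  False.
Proof.
move=> hh c0 eta0 hB hd.
have dfh F : df F -> df (fun e => h (F e)) by apply: df_fun1.
(* The estimate for all pairs of points near [v], on both sides: the continuity argument below needs
   a neighbourhood of each point. *)
pose good v := exists2 d, 0 < d & forall u u', v - d < u -> u < u' -> u' < v + d ->
  c * (u' - u) <= u * (h u' - h u).
have sagood : sa1 good by apply: sa_ex2; sa_tac; apply: dfh; df_tac.
have [e2 e20 [e2eta hgood]] : exists2 e2, 0 < e2 & e2 <= eta /\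
    forall v, 0 < v -> v < e2 -> good v.
  case: (eventually_dec 0 sagood) => -[e1 e10 he1].
    exists (Num.min e1 eta); first by rewrite lt_min e10.
    split; first by rewrite ge_min lexx orbT.
    by move=> v v0; rewrite lt_min => /andP[ve1 _]; apply: he1; rewrite ?add0r.
  (* If [good] failed near [0], a uniform radius on a subinterval would still make its midpoint
     good. *)
  case: (@sa_uniform _ (fun d v => forall u, v < u -> u < v + d ->
    c * (u - v) <= v * (h u - h v)) 0 (Num.min e1 eta)).
  - by sa_tac; apply: dfh; df_tac.
  - by move=> d d' v dd' H u vu ud; apply: H => //; lra.
  - by rewrite lt_min e10.
  - by move=> v v0; rewrite lt_min => /andP[_ /(hd v v0)].
  move=> d [a' [b' [d0 a'0 a'b']]]; rewrite le_min => /andP[b'1 b'2] H; exfalso.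
  apply: (he1 ((a' + b') / 2%:R)); [lra|lra|].
  pose r := Num.min d ((b' - a')) / 2%:R.
  have r1 : r <= d / 2%:R by rewrite ler_pM2r ?invr_gt0 // ge_min lexx.
  have r2 : r <= (b' - a') / 2%:R by rewrite ler_pM2r ?invr_gt0 // ge_min lexx orbT.
  exists r; first by rewrite divr_gt0 // lt_min d0 subr_gt0.
  by move=> u u' h1 h2 h3; apply: H; lra.
have hdouble v : 0 < v -> 2%:R * v < e2 -> c <= 2%:R * (h (2%:R * v) - h v).
  move=> v0 v2.
  have step u u' : 0 < u -> u <= u' -> u <= 2%:R * v -> c * (u' - u) <= u * (h u' - h u) ->
      c * (u' - u) <= 2%:R * v * (h u' - h u).
    move=> u0 uu' uv H; apply: (le_trans H); apply: ler_wpM2r => //.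
    have : 0 <= u * (h u' - h u) by apply: (le_trans _ H); apply: mulr_ge0; lra.
    by rewrite pmulr_rge0.
  (* Continuity induction from [v] to [2 v]: by [good] at the supremum of [S], the estimate extends
     past it. The weight is frozen at its largest value [2 v], so that estimates add up. *)
  pose S t := (v <= t /\ t <= 2%:R * v) /\ forall u, v <= u -> u <= t ->
    c * (u - v) <= 2%:R * v * (h u - h v).
  have Sv : S v.
    split; first by lra.
    move=> u vu uv; have -> : u = v by apply/eqP; rewrite eq_le vu uv.
    by rewrite !subrr !mulr0.
  have [|||t [ht1 ht2]] := @sa1_sup _ S.
  - by rewrite /sa1 /S; sa_tac; apply: dfh; df_tac.
  - by exists v.
  - by exists (2%:R * v) => x [[]].
  have vt := ht1 _ Sv.
  have tv : t <= 2%:R * v.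
    by rewrite leNgt; apply/negP => /ht2[x [[_ h1] _]]; lra.
  have [||d d0 hgd] := hgood t; [lra|lra|].
  have [|t0 St0 t0t] := ht2 (t - d); first lra.
  have t0le := ht1 _ St0.
  have Sr r : v <= r -> r < t + d -> r <= 2%:R * v -> S r.
    move=> vr rt rv; split=> // u vu ur.
    case: (leP u t0) => ut0; first by case: St0 => _; apply.
    have [[vt0 _] /(_ t0 vt0 (lexx _)) H0] := St0.
    have H1 : c * (u - t0) <= 2%:R * v * (h u - h t0).
      by apply: step; [lra|lra|lra|apply: hgd; lra].
    have -> : c * (u - v) = c * (u - t0) + c * (t0 - v) by ring.
    have -> : 2%:R * v * (h u - h v) =
      2%:R * v * (h u - h t0) + 2%:R * v * (h t0 - h v) by ring.
    exact: lerD.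
  have St2 : S (2%:R * v).
    apply: (Sr); rewrite ?lexx //; first lra.
    rewrite ltNge; apply/negP => tdv.
    have /ht1 : S (t + d / 2%:R) by apply: Sr; lra.
    lra.
  have [_ /(_ (2%:R * v))] := St2; rewrite lexx.
  have vv : v <= 2%:R * v by lra.
  move=> /(_ vv isT); rewrite (_ : 2%:R * v - v = v); last by ring.
  by rewrite (mulrC 2%:R v) -mulrA (mulrC c) ler_pM2l.
(* A value of [h] within [c / 2] of the infimum is undercut at half the argument. *)
have [|||m [hm1 hm2]] := @sa1_inf _ (fun t => exists v, (0 < v /\ v < e2) /\ t = h v).
- by rewrite /sa1; sa_tac; apply: dfh; df_tac.
- by exists (h (e2 / 2%:R)), (e2 / 2%:R); split=> //; lra.
- exists (- B) => x [v [[v0 v1] ->]].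
  by have := hB v v0 (lt_le_trans v1 e2eta); rewrite ler_norml => /andP[].
have [|x [v [[v0 v1] ->]] hv] := hm2 (m + c / 2%:R); first lra.
have v2 : 2%:R * (v / 2%:R) = v by field.
have := hdouble (v / 2%:R); rewrite v2.
have vh : 0 < v / 2%:R by lra.
move=> /(_ vh v1).
have : m <= h (v / 2%:R) by apply: hm1; exists (v / 2%:R); split=> //; lra.
lra.
Qed.

(** A canonical point of a definable compact set: being unique and definable, it yields
    semi-algebraic choice functions. *)
Definition lexmin n (A : ('I_n -> R) -> Prop) y := A y /\
  forall z, A z -> forall i : 'I_n, (forall j : 'I_n, (j < i)%N -> z j = y j) -> y i <= z i.

Lemma lexmin_uniq n (A : ('I_n -> R) -> Prop) y z : lexmin A y -> lexmin A z -> y = z.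
Proof.
move=> [Ay hy] [Az hz]; apply: functional_extensionality => i.
have [k ik] := ubnP (val i); elim: k i ik => // k IH i ik.
have yz (j : 'I_n) : (j < i)%N -> y j = z j by move=> ji; apply: IH; exact: leq_trans ji _.
by apply/eqP; rewrite eq_le hy ?hz // => j /yz.
Qed.

(** Coordinates are minimised in turn, each on the slice where the earlier ones are fixed, which
    stays closed and bounded. *)
Lemma lexmin_exists n (A : ('I_n -> R) -> Prop) B :
  saS A -> closedS A -> boundedS A B -> (exists y, A y) -> exists y, lexmin A y.
Proof.
move=> hA Acl Ab Ane.
suff H k : exists2 y, A y & forall z, A z -> forall i : 'I_n, (i < k)%N ->
    (forall j : 'I_n, (j < i)%N -> z j = y j) -> y i <= z i.
  by have [y Ay hy] := H n; exists y; split=> // z Az i; apply: hy.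
elim: k => [|k [y Ay hy]]; first by case: Ane => y Ay; exists y.
case: (ltnP k n) => kn; last first.
  by exists y => // z Az i _; apply: hy => //; exact: leq_trans (ltn_ord i) kn.
have [|||||||y' [Ay' y'y] hy'] := @extreme_value _ _
  (fun z => A z /\ forall j : 'I_n, (j < k)%N -> z j = y j) (fun z => z (Ordinal kn)) B.
- apply: sa_and => //; apply: sa_fin_all => j; apply: sa_imp; first exact: sa_const.
  by apply: sa_eq; df_tac.
- exact: df_var.
- apply: closed_and => //; apply: closed_all => j p hp jk.
  apply/eqP; rewrite -subr_eq0 -normr_le0 leNgt; apply/negP => h.
  have [z /(_ jk) zy /(_ j)] := hp _ h.
  by rewrite zy distrC ltxx.
- by move=> z [/Ab].
- by move=> p _; apply: cont_coord.
- by exists y.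
- exists (- B) => z [Az _].
  by have := Ab _ Az (Ordinal kn); rewrite ler_norml => /andP[].
exists y' => // z Az i; rewrite ltnS leq_eqVlt => /orP[/eqP ik|ik] hz.
  have -> : i = Ordinal kn by apply: val_inj.
  apply: hy'; split=> // j jk; rewrite hz ?ik // y'y //.
rewrite y'y //; apply: hy => // j ji; rewrite hz // y'y //.
exact: ltn_trans ji ik.
Qed.

End OneVariable.

Lemma sa_subst_vec (R : rcfType) n (P : R -> ('I_n -> R) -> Prop) (F0 : (nat -> R) -> R)
    (F : 'I_n -> (nat -> R) -> R) :
  sa (fun e => P (e n) (fun i => e i)) -> pfun F0 -> (forall i, pfun (F i)) ->
  sa (fun e => P (F0 e) (fun i => F i e)).
Proof.
move=> hP h0 hF.
have := @sa_subst R (fun k e => if k == n then F0 e else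
  if insub k is Some i then F i e else 0) _ _ hP.
rewrite (_ : (fun _ => _) = (fun e => P (F0 e) (fun i => F i e))); first apply.
  by move=> k; case: eqP => // _; case: insubP => [i _ _|_]; [apply: hF|apply: pfun_cst].
apply: functional_extensionality => e; rewrite eqxx; congr P.
by apply: functional_extensionality => i; rewrite ltn_eqF // valK.
Qed.

(** * Curves of points with small gradient *)

Section Qualitative.
Variables (R : rcfType) (n : nat) (f : {mpoly R[n]}).

(** The equation [f = v] is written as two weak inequalities so that [closed_le] applies. A failure
    of [gradient_dominates] makes these sets nonempty for arbitrarily small [v]. *)
Let level (B T v : R) (y : 'I_n -> R) := (forall i, `|y i| <= B) /\
  ((f.@[y] <= v /\ v <= f.@[y]) /\ forall i, `|(f^`M(i)).@[y]| <= T * v).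

Lemma df_norm (F : (nat -> R) -> R) : df F -> df (fun e => `|F e|).
Proof.
apply: (@df_fun1 _ Num.norm).
apply: (@sa_iff _ (fun e => (e 1%N < 0 /\ e 0%N = - e 1%N) \/ (~ (e 1%N < 0) /\ e 0%N = e 1%N))).
  move=> e; case: (ltrP (e 1%N) 0) => h.
    by rewrite (ltr0_norm h); split=> [[[]|[]]|] //; left.
  by rewrite (ger0_norm h); split=> [[[]|[]]|] //; right.
by apply: sa_or; sa_tac.
Qed.

Lemma sa_level B T : sa (fun e : nat -> R => level B T (e n) (fun i => e i)).
Proof.
have hm (g : {mpoly R[n]}) : df (fun e : nat -> R => g.@[fun i => e i]).
  by apply/df_pfun/pfun_meval => i; apply: pfun_var.
apply: sa_and; last apply: sa_and.
- by apply: sa_fin_all => i; sa_tac; apply: df_norm; df_tac.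
- by sa_tac.
- by apply: sa_fin_all => i; sa_tac; apply: df_norm.
Qed.

Lemma cont_norm (F : ('I_n -> R) -> R) p : cont_at F p -> cont_at (fun y => `|F y|) p.
Proof.
move=> hF e e0; have [d d0 h] := hF _ e0; exists d => // y /h.
by apply: le_lt_trans; exact: ler_dist_dist.
Qed.

Lemma closed_level B T v : closedS (level B T v).
Proof.
apply: closed_and; last apply: closed_and.
- apply: closed_all => i; apply: closed_le => p; last exact: cont_cst.
  by apply: cont_norm; exact: cont_coord.
- by apply: closed_and; apply: closed_le => p; do ?[exact: cont_cst|exact: cont_meval].
- apply: closed_all => i; apply: closed_le => p; last exact: cont_cst.
  by apply: cont_norm; exact: cont_meval.
Qed.

(** The curve [y(v)], with default [0] where the level set is empty. *)
Definition lexlevel B T v : 'I_n -> R :=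
  match excluded_middle_informative (exists y, level B T v y) with
  | left _ => epsilon (inhabits (fun=> 0)) (lexmin (level B T v))
  | right _ => fun=> 0
  end.

Lemma lexlevelP B T v : (exists y, level B T v y) ->
  lexmin (level B T v) (lexlevel B T v).
Proof.
rewrite /lexlevel; case: excluded_middle_informative => // ex _.
apply: epsilon_spec; apply: (@lexmin_exists _ _ _ B) => //.
- apply: (@sa_iff _ (fun e => exists t, t = v /\ level B T t (fun i => e i))).
    by move=> e; split=> [[t [-> //]]|h]; exists v.
  apply: sa_ex; apply: sa_and; first by sa_tac.
  have h := sa_level B T.
  by apply: (sa_subst_vec (F0 := fun e => e 0%N) (F := fun i e => e i.+1) h) => [|i]; exact: pfun_var.
- exact: closed_level.
- by move=> y [].
Qed.

(** Uniqueness of the lexicographic minimum lets the graph be described by a first-order formula,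
    although the point itself is picked by [epsilon]. *)
Lemma sa_lexlevel B T i : sa (fun e => e 0%N = lexlevel B T (e 1%N) i).
Proof.
have hl := sa_level B T.
apply: (@sa_iff _ (fun e => (exists y, lexmin (level B T (e 1%N)) y /\ e 0%N = y i) \/
  (~ (exists y, level B T (e 1%N) y) /\ e 0%N = 0))).
  move=> e; split.
    case=> [[y [hy ->]]|[no ->]].
      have ex : exists y, level B T (e 1%N) y by exists y; case: hy.
      by rewrite (lexmin_uniq hy (lexlevelP ex)).
    by rewrite /lexlevel; case: excluded_middle_informative.
  move=> ->; case: (classic (exists y, level B T (e 1%N) y)) => ex.
    by left; exists (lexlevel B T (e 1%N)); split=> //; exact: lexlevelP.
  by right; split=> //; rewrite /lexlevel; case: excluded_middle_informative.
apply: sa_or; last apply: sa_and.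
- apply: sa_exn; apply: sa_and; last by sa_tac.
  apply: sa_and; first by apply: (sa_subst_vec hl) => [|j]; exact: pfun_var.
  apply: sa_alln; apply: sa_imp.
    by apply: (sa_subst_vec hl) => [|j]; exact: pfun_var.
  apply: sa_fin_all => j; apply: sa_imp; last by sa_tac.
  by apply: sa_fin_all => k; apply: sa_imp; [exact: sa_const|sa_tac].
- by apply/sa_not/sa_exn; apply: (sa_subst_vec hl) => [|j]; exact: pfun_var.
- by sa_tac.
Qed.

Lemma gradient_dominates B T : 0 <= B -> 0 < T -> exists2 eta, 0 < eta &
  forall y : 'I_n -> R, (forall i, `|y i| <= B) -> 0 < f.@[y] -> f.@[y] < eta ->
  exists i, T * f.@[y] < `|(f^`M(i)).@[y]|.
Proof.
move=> B0 T0; apply: NNPP => no.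
have [] := eventually_dec 0 (P := fun v => exists y, level B T v y).
- by apply: sa_exn; apply: (sa_subst_vec (sa_level B T)) => [|i]; exact: pfun_var.
- move=> [eta eta0 heta].
  pose Y := lexlevel B T.
  have hY v : 0 < v -> v < eta -> level B T v (Y v).
    by move=> v0 v1; have [] := lexlevelP (heta v v0 _); rewrite ?add0r.
  (* The term [2 n T] keeps the linear part of the Taylor expansion below half of the increment. *)
  pose K := 2%:R * n%:R * T + 1.
  have n0 : 0 <= n%:R :> R by rewrite ler0n.
  have K0 : 0 < K by rewrite /K; have := mulr_ge0 n0 (ltW T0); lra.
  have [C C0 hC] := taylor_mpoly f B0.
  (* Along the curve [f] grows by [u - v] while its partial derivatives are at most [T v], so some
     coordinate moves by at least [(u - v) / (K v)]. *)
  have expand v : 0 < v -> v < eta ->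
      eventually v (fun u => exists i, u - v <= K * v * `|Y u i - Y v i|).
    (* The second bound keeps the quadratic remainder at most half of the increment. *)
    move=> v0 v1; pose d := Num.min (eta - v) (K ^+ 2 * v ^+ 2 / (2%:R * (C + 1))).
    have Kv : 0 < K * v by rewrite mulr_gt0.
    exists d.
      rewrite lt_min subr_gt0 v1 /= divr_gt0 ?mulr_gt0 ?exprn_gt0 //; lra.
    move=> u vu; have -> : (u < v + d) = (u - v < d) by rewrite ltrBlDl.
    rewrite lt_min => /andP[u1 u2]; apply: NNPP => noi.
    have [hv1 [[hv2 hv3] hv4]] := hY v v0 v1.
    have [||hu1 [[hu2 hu3] hu4]] := hY u; [lra|lra|].
    have fv : f.@[Y v] = v by apply/eqP; rewrite eq_le hv2 hv3.
    have fu : f.@[Y u] = u by apply/eqP; rewrite eq_le hu2 hu3.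
    pose m := (u - v) / (K * v).
    have m0 : 0 <= m by rewrite divr_ge0 ?ltW // subr_gt0.
    have hm i : `|Y u i - Y v i| <= m.
      rewrite ler_pdivlMr // mulrC leNgt; apply/negP => h; apply: noi; exists i.
      exact: ltW.
    have [_ _ hr] := hC (Y v) (Y u) m hv1 hu1 m0 hm.
    have hs : `|\sum_i (f^`M(i)).@[Y v] * (Y u i - Y v i)| <= n%:R * (T * v * m).
      apply: le_trans (ler_norm_sum _ _ _) _.
      rewrite -[n in n%:R]card_ord mulr_natl -sumr_const.
      by apply: ler_sum => i _; rewrite normrM; apply: ler_pM.
    have key : u - v <= C * m ^+ 2 + n%:R * (T * v * m).
      have -> : u - v = taylor_rem f (Y v) (Y u) + \sum_i (f^`M(i)).@[Y v] * (Y u i - Y v i).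
        by rewrite /taylor_rem fu fv subrK.
      apply: le_trans (ler_norm _) _; apply: le_trans (ler_normD _ _) _.
      exact: lerD.
    have mE : m * (K * v) = u - v by rewrite divfK // gt_eqF.
    have uv0 : 0 < u - v by rewrite subr_gt0.
    have m1 : 0 < m by rewrite divr_gt0.
    have h1 : 2%:R * (n%:R * (T * v * m)) < u - v.
      rewrite -mE; have -> : m * (K * v) = 2%:R * (n%:R * (T * v * m)) + m * v by rewrite /K; ring.
      by rewrite ltrDl mulr_gt0.
    have h2 : 2%:R * (C * m ^+ 2) <= u - v.
      move: u2; rewrite ltr_pdivlMr; last by lra.
      rewrite -exprMn -mE => h.
      have : m * (2%:R * (C + 1)) < K * v.
        by rewrite -(ltr_pM2r Kv); apply: le_lt_trans h; rewrite mulrAC.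
      move=> h'; have : m * (m * (2%:R * (C + 1))) < m * (K * v) by rewrite ltr_pM2l.
      have : 0 < m ^+ 2 by rewrite exprn_gt0.
      have -> : m * (m * (2%:R * (C + 1))) = 2%:R * (C * m ^+ 2) + 2%:R * m ^+ 2 by ring.
      lra.
    lra.
  have hYi i F : df F -> df (fun e => Y (F e) i).
    by apply: (@df_fun1 _ (fun v => Y v i)); exact: sa_lexlevel.
  (* [q] records a coordinate and the sign of its motion. The pigeonhole fixes it first for [u]
     close to each [v], then for all small [v]. *)
  pose P (q : 'I_n * bool) v u := u - v <= K * v * ((-1) ^+ q.2 * (Y u q.1 - Y v q.1)).
  have hP v : 0 < v -> v < eta -> exists q, eventually v (P q v).
    move=> v0 v1; apply: eventually_pigeonhole.
      by move=> q; rewrite /sa1 /P; sa_tac; apply: hYi; df_tac.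
    move=> e e0; have [u [vu ue [i hi]]] := eventually_wit (expand v v0 v1) e0.
    exists u; split=> //; rewrite /P.
    case: (lerP 0 (Y u i - Y v i)) => s.
      by exists (i, false); rewrite expr0 mul1r -(ger0_norm s).
    by exists (i, true); rewrite expr1 mulN1r -(ltr0_norm s).
  have [] := @eventually_pigeonhole _ ('I_n * bool)%type 0 (fun q v => eventually v (P q v)).
  - by move=> q; apply: sa_ex2; rewrite /P; sa_tac; apply: hYi; df_tac.
  - move=> e e0; exists (Num.min e eta / 2%:R).
    have l1 : Num.min e eta <= e by rewrite ge_min lexx.
    have l2 : Num.min e eta <= eta by rewrite ge_min lexx orbT.
    have l0 : 0 < Num.min e eta by rewrite lt_min e0.
    by split; [lra|lra|apply: hP; lra].
  move=> q [e e0 he].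
  apply: (@tame_no_blowup _ (fun v => (-1) ^+ q.2 * Y v q.1) K^-1 B (Num.min e eta)).
  - by sa_tac; apply: hYi; df_tac.
  - by rewrite invr_gt0.
  - by rewrite lt_min e0.
  - move=> v v0; rewrite lt_min => /andP[_ v1]; rewrite normrM normrX normrN1 expr1n mul1r.
    by have [h _] := hY v v0 v1; apply: h.
  - move=> v v0; rewrite lt_min => /andP[ve _].
    have [|d d0 hd] := he v v0; first by rewrite add0r.
    exists d => // u vu ud; have := hd u vu ud; rewrite /P => h.
    by rewrite mulrC ler_pdivrMr // -mulrBr mulrC mulrA.
- move=> [eta eta0 heta]; apply: no; exists eta => // y hy f0 f1.
  apply: NNPP => noi; apply: (heta f.@[y]); rewrite ?add0r //.
  exists y; split=> //; split=> // i; rewrite leNgt; apply/negP => h.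
  by apply: noi; exists i.
Qed.

End Qualitative.

(** * Critical values as roots of a characteristic polynomial *)

Section Elimination.
Variables (R : rcfType) (n : nat).
Notation A := {poly {poly R}}.

(* In [{poly {poly R}}] the outer variable is [l] and the inner one is [w]. *)
Definition ev2 (w l : R) (a : A) : R := a.[l%:P].[w].

Lemma ev2D w l a b : ev2 w l (a + b) = ev2 w l a + ev2 w l b.
Proof. by rewrite /ev2 !hornerD. Qed.
Lemma ev2M w l a b : ev2 w l (a * b) = ev2 w l a * ev2 w l b.
Proof. by rewrite /ev2 !hornerM. Qed.
Lemma ev2C w l c : ev2 w l c%:P%:P = c.
Proof. by rewrite /ev2 !hornerC. Qed.
Definition mon (y : 'I_n -> R) (m : 'X_{1..n}) : R := \prod_i y i ^+ m i.

Lemma monD y m m' : mon y (m + m')%MM = mon y m * mon y m'.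
Proof. by rewrite /mon -big_split; apply: eq_bigr => i _; rewrite mnmDE exprD. Qed.
Lemma mon0 y : mon y 0%MM = 1.
Proof. by rewrite /mon big1 // => i _; rewrite mnm0E. Qed.

Notation terms := (seq (A * 'X_{1..n})).
Definition sem (T : terms) w l y := \sum_(t <- T) ev2 w l t.1 * mon y t.2.
Definition bnd (D E : nat) (T : terms) :=
  all (fun t : A * 'X_{1..n} => (size t.1 <= E.+1)%N && (mdeg t.2 <= D)%N) T.

(** Degrees are recorded in [y] and in [l] only, since the final exponent is bounded by a degree in
    [l]. *)
Definition tf (D E : nat) (G : R -> R -> ('I_n -> R) -> R) :=
  exists2 T, bnd D E T & forall w l y, G w l y = sem T w l y.

Lemma tf_weak D E D' E' G : (D <= D')%N -> (E <= E')%N -> tf D E G -> tf D' E' G.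
Proof.
move=> hD hE [T hT h]; exists T => //; apply/allP => t /(allP hT) /andP[h1 h2].
by rewrite (leq_trans h1) ?(leq_trans h2).
Qed.

Lemma tfD D E G H : tf D E G -> tf D E H -> tf D E (fun w l y => G w l y + H w l y).
Proof.
move=> [T hT h] [S hS h']; exists (T ++ S); first by rewrite /bnd all_cat; apply/andP.
by move=> w l y; rewrite /sem big_cat h h'.
Qed.

Lemma tf_term D E (a : A) (m : 'X_{1..n}) : (size a <= E.+1)%N -> (mdeg m <= D)%N ->
  tf D E (fun w l y => ev2 w l a * mon y m).
Proof.
move=> h1 h2; exists [:: (a, m)]; first by rewrite /bnd /= h1 h2.
by move=> w l y; rewrite /sem big_seq1.
Qed.

Lemma tf_ext D E G H : (forall w l y, G w l y = H w l y) -> tf D E G -> tf D E H.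
Proof. by move=> GH [T hT h]; exists T => // w l y; rewrite -GH. Qed.

Lemma tf_sum D E I (r : seq I) (G : I -> R -> R -> ('I_n -> R) -> R) :
  (forall i, tf D E (G i)) -> tf D E (fun w l y => \sum_(i <- r) G i w l y).
Proof.
move=> hG; elim: r => [|i r IH].
  by exists [::] => // w l y; rewrite /sem !big_nil.
by apply: tf_ext (tfD (hG i) IH) => w l y; rewrite big_cons.
Qed.

Lemma tfM D E D' E' G H : tf D E G -> tf D' E' H ->
  tf (D + D') (E + E') (fun w l y => G w l y * H w l y).
Proof.
move=> [T hT h] [S hS h'].
exists [seq (t.1 * s.1, (t.2 + s.2)%MM) | t <- T, s <- S].
  apply/allP => _ /allpairsP[[t s] [/= /(allP hT)/andP[a b] /(allP hS)/andP[c d] ->]] /=.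
  rewrite mdegD leq_add // andbT; apply: leq_trans (size_polyMleq _ _) _; 
  by rewrite -subn1 leq_subLR add1n; apply: leq_trans (leq_add a c) _; rewrite addSn addnS.
move=> w l y; rewrite h h' /sem big_allpairs_dep /= big_distrl /=.
apply: eq_bigr => t _; rewrite big_distrr /=; apply: eq_bigr => s _.
by rewrite ev2M monD mulrACA.
Qed.

Lemma tfC c : tf 0 0 (fun _ _ _ => c).
Proof.
have := @tf_term 0 0 c%:P%:P 0%MM; rewrite mdeg0 size_polyC => /(_ (leq_b1 _) isT).
by apply: tf_ext => w l y; rewrite ev2C mon0 mulr1.
Qed.

Lemma tf_w : tf 0 0 (fun w _ _ => w).
Proof.
have := @tf_term 0 0 ('X%:P) 0%MM; rewrite mdeg0 size_polyC => /(_ (leq_b1 _) isT).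
by apply: tf_ext => w l y; rewrite /ev2 hornerC hornerX mon0 mulr1.
Qed.

Lemma tf_l : tf 0 1 (fun _ l _ => l).
Proof.
have := @tf_term 0 1 'X 0%MM; rewrite mdeg0 size_polyX => /(_ isT isT).
by apply: tf_ext => w l y; rewrite /ev2 hornerX hornerC mon0 mulr1.
Qed.

Lemma tf_mpoly D (f : {mpoly R[n]}) : (msize f <= D.+1)%N -> tf D 0 (fun _ _ y => f.@[y]).
Proof.
move=> sf; exists [seq ((f@_m)%:P%:P, m) | m <- msupp f].
  apply/allP => _ /mapP[m mf ->] /=; rewrite size_polyC leq_b1 -ltnS.
  exact: leq_trans (msize_mdeg_lt mf) sf.
by move=> w l y; rewrite mevalE /sem [RHS]big_map; apply: eq_bigr => m _; rewrite ev2C.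
Qed.

(** * Reduction modulo the relations [y i ^+ k = G i] *)

Variables (k D1 : nat) (G : 'I_n -> R -> R -> ('I_n -> R) -> R).
Hypothesis D1k : (D1 < k)%N.
Hypothesis tfG : forall i, tf D1 1 (G i).

Definition solves w l (y : 'I_n -> R) := forall i, y i ^+ k = G i w l y.

Notation box := {ffun 'I_n -> 'I_k}.
Definition bm (b : box) : 'X_{1..n} := [multinom (b i : nat) | i < n].

(** A normal form in the monomials with all exponents below [k], valid at solutions of the
    relations. *)
Definition reduces E (F : R -> R -> ('I_n -> R) -> R) := exists2 b : box -> A,
  (forall g, (size (b g) <= E.+1)%N) &
  forall w l y, solves w l y -> F w l y = \sum_g ev2 w l (b g) * mon y (bm g).

Lemma reduces_sem E s T : (forall m, (mdeg m <= s)%N -> reduces s (fun _ _ y => mon y m)) ->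
  bnd s E T -> reduces (E + s) (sem T).
Proof.
move=> hm; elim: T => [_|[a m] T IH /= /andP[/andP[sa mm] /IH[b sb hb]]].
  exists (fun=> 0) => [g|w l y _]; first by rewrite size_poly0.
  by rewrite /sem big_nil big1 // => g _; rewrite /ev2 !horner0 mul0r.
have [c sc hc] := hm m mm; exists (fun g => a * c g + b g).
  move=> g; apply: leq_trans (size_polyD _ _) _; rewrite geq_max sb andbT.
  apply: leq_trans (size_polyMleq _ _) _; rewrite -subn1 leq_subLR add1n.
  by apply: leq_trans (leq_add sa (sc g)) _; rewrite addSn addnS.
move=> w l y hy; rewrite /sem big_cons -/(sem T w l y) hb //= (hc w l) //.
rewrite mulr_sumr -big_split; apply: eq_bigr => g _ /=.
by rewrite ev2D ev2M mulrDl mulrA.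
Qed.

(** Replacing [y i ^+ k] by [G i] lowers the total degree, since [D1 < k], and raises the degree in
    [l] by at most one; so at most [s] replacements are nested. *)
Lemma reduces_mon s m : (mdeg m <= s)%N -> reduces s (fun _ _ y => mon y m).
Proof.
elim: s m => [|s IH] m ms.
all: case: (boolP [forall i, (m i < k)%N]) => [/forallP hm|].
1,3: exists (fun g => (g == [ffun i => Ordinal (hm i)])%:R) => [g|w l y _];
  [by case: (_ == _); rewrite ?size_poly1 ?size_poly0|
   rewrite (bigD1 [ffun i => Ordinal (hm i)]) //= eqxx big1 => [|g /negPf ->];
   [rewrite addr0 /ev2 !hornerC mul1r; congr mon; apply/mnmP => i; rewrite mnmE ffunE //
   |by rewrite /ev2 !horner0 mul0r]].
all: rewrite negb_forall => /existsP[i]; rewrite -leqNgt => ki.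
- have : (m i <= mdeg m)%N by rewrite mdegE (bigD1 i) //= leq_addr.
  lia.
have mi : (U_(i) *+ k <= m)%MM.
  by apply/mnm_lepP => j; rewrite mulmnE mnm1E; case: eqP => [<-|]; rewrite ?mul1n ?mul0n.
pose m' := (m - U_(i) *+ k)%MM.
have mE : m = (m' + U_(i) *+ k)%MM by rewrite submK.
have [T hT hG] := tfG i.
have dm : (mdeg m' + k)%N = mdeg m.
  by rewrite [in RHS]mE mdegD mdegMn mdeg1 mul1n.
pose T' : terms := [seq (t.1, (m' + t.2)%MM) | t <- T].
have hT' : bnd s 1 T'.
  apply/allP => _ /mapP[t /(allP hT) /andP[h1 h2] ->] /=.
  by rewrite h1 mdegD /=; lia.
have [b sb hb] := reduces_sem IH hT'; rewrite add1n in sb.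
exists b => // w l y hy; rewrite -hb // mE monD.
have -> : mon y (U_(i) *+ k) = y i ^+ k.
  rewrite /mon (bigD1 i) //= big1 => [|j ji].
    by rewrite mulmnE mnm1E eqxx mul1n mulr1.
  by rewrite mulmnE mnm1E eq_sym (negPf ji) mul0n expr0.
rewrite hy hG /sem big_map mulr_sumr; apply: eq_bigr => t _ /=.
by rewrite monD mulrCA.
Qed.

Lemma size_prod_ord N E (F : 'I_N -> A) : (forall i, (size (F i) <= E.+1)%N) ->
  (size (\prod_i F i)%R <= (N * E).+1)%N.
Proof.
move=> hF; apply: leq_trans (size_poly_prod_leq _ _) _.
have : (\sum_(i < N) size (F i) <= N * E.+1)%N.
  have -> : (N * E.+1 = \sum_(i < N) E.+1)%N by rewrite sum_nat_const card_ord.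
  by apply: leq_sum => i _; apply: hF.
by rewrite card_ord leq_subLR addnS ltnS mulnS.
Qed.

Lemma size_det_le N E (M : 'M[A]_N) : (forall i j, (size (M i j) <= E.+1)%N) ->
  (size (\det M) <= (N * E).+1)%N.
Proof.
move=> hM; apply: (leq_trans (size_sum _ _ _)); apply/bigmax_leqP => s _.
have sg (b : bool) (p : A) : size ((-1) ^+ b * p) = size p.
  by case: b; rewrite ?expr1 ?expr0 ?mulN1r ?size_polyN ?mul1r.
by rewrite sg; apply: size_prod_ord => i; apply: hM.
Qed.

(** There are fewer than [size p] roots, so one of [size p] sample points of the interval is not a
    root. *)
Lemma exists_nonroot (p : {poly A}) (a0 a1 : R) : p != 0 -> a0 < a1 ->
  exists2 a, a0 < a < a1 & p.[a%:P%:P] != 0.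
Proof.
move=> p0 a01; apply: NNPP => no.
pose v (j : 'I_(size p)) : R := a0 + (a1 - a0) * (j.+1%:R / (size p).+1%:R).
have vin j : a0 < v j < a1.
  have s0 : 0 < (size p).+1%:R :> R by rewrite ltr0n.
  have j1 : 0 < (j.+1%:R / (size p).+1%:R : R) by rewrite divr_gt0 ?ltr0n.
  have j2 : (j.+1%:R / (size p).+1%:R : R) < 1 by rewrite ltr_pdivrMr // mul1r ltr_nat ltnS.
  have ba : 0 < a1 - a0 by rewrite subr_gt0.
  by rewrite /v ltrDl mulr_gt0 //= -ltrBrDl gtr_pMr.
have vinj : injective v.
  move=> i j /addrI /mulfI; rewrite subr_eq0 gt_eqF // => /(_ isT) /mulIf.
  rewrite invr_eq0 pnatr_eq0 => /(_ isT) /eqP; rewrite eqr_nat eqSS => /eqP.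
  exact: val_inj.
have := @max_poly_roots _ p [seq (v j)%:P%:P | j <- enum 'I_(size p)] p0.
rewrite size_map size_enum_ord ltnn => H; suff : false by []; apply: H.
  apply/allP => _ /mapP[j _ ->]; apply/negPn/negP => h; apply: no.
  by exists (v j).
by rewrite map_inj_uniq ?enum_uniq // => i j /polyC_inj /polyC_inj /vinj.
Qed.

(* [y ^ bm g], for [g] in the box, is an eigenvector of the matrix describing
   multiplication by [F] modulo the relations [y i ^+ k = G i]. *)
Lemma critical_value_eqn D0 F a0 a1 : tf D0 1 F -> a0 < a1 ->
  exists2 a, a0 < a < a1 & exists chi : A, [/\ chi != 0,
    (size chi <= (k ^ n * (1 + (D0 + n * k))).+1)%N &
    forall w l y, solves w l y -> F w l y = a -> ev2 w l chi = 0].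
Proof.
(* [F] times a box monomial has degree at most [D0 + n * k] in [y] and [1] in [l]; reduction adds
   the former to the latter. *)
move=> hF a01; set E := (1 + (D0 + n * k))%N.
have row (b : box) : exists c : box -> A, (forall g, (size (c g) <= E.+1)%N) /\
    forall w l y, solves w l y -> F w l y * mon y (bm b) = \sum_g ev2 w l (c g) * mon y (bm g).
  have : tf (D0 + n * k) 1 (fun w l y => F w l y * mon y (bm b)).
    have := @tf_term (n * k) 0 1 (bm b); rewrite size_poly1 mdegE => /(_ isT) h.
    have {}h := tfM hF (h _); rewrite addn0 in h; apply: tf_ext (h _) => [w l y|].
      by rewrite /ev2 !hornerC mul1r.
    have -> : (n * k = \sum_(i < n) k)%N by rewrite sum_nat_const card_ord.
    apply: leq_sum => i _.
    by rewrite mnmE ltnW.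
  move=> [T hT h]; have [c sc hc] := reduces_sem (@reduces_mon _) hT.
  by exists c; split=> // w l y hy; rewrite h hc.
have [c hc] := fin_all_exists row.
pose N := #|box|.
pose M : 'M[A]_N := \matrix_(i, j) c (enum_val i) (enum_val j).
have cp0 : char_poly M != 0 by rewrite monic_neq0 // char_poly_monic.
(* The characteristic polynomial specialised at [a] must not be the zero polynomial, which excludes
   finitely many [a]. *)
have [a aI ha] := exists_nonroot cp0 a01.
exists a => //; pose chi : A := \det (a%:P%:P%:M - M).
exists chi; split.
- rewrite /chi; have -> // : \det (a%:P%:P%:M - M) = (char_poly M).[a%:P%:P].
  rewrite /char_poly -horner_evalE -det_map_mx; congr (\det _).
  apply/matrixP => i j; rewrite !mxE /= /horner_eval.
  by rewrite hornerD hornerN hornerC hornerMn hornerX.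
- have -> : (k ^ n)%N = N by rewrite /N card_ffun !card_ord.
  apply: size_det_le => i j; rewrite !mxE; apply: leq_trans (size_polyD _ _) _.
  rewrite size_polyN geq_max; apply/andP; split; last by case: (hc (enum_val i)).
  case: (i == j); rewrite ?mulr1n ?mulr0n ?size_poly0 //.
  by apply: leq_trans (size_polyC_leq1 _) _.
- move=> w l y hy hFa.
  have k0 : (0 < k)%N by apply: leq_ltn_trans D1k.
  rewrite /ev2 -!horner_evalE -!det_map_mx -det_tr; apply/eqP/det0P.
  exists (\row_j mon y (bm (enum_val j))).
    (* The vector is nonzero because its entry at the monomial [1] equals [1]. *)
    apply/eqP => /matrixP /(_ 0 (enum_rank [ffun=> Ordinal k0])).
    rewrite !mxE enum_rankK => /eqP; rewrite (_ : bm _ = 0%MM) ?mon0 ?oner_eq0 //.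
    by apply/mnmP => i; rewrite mnmE ffunE mnm0E.
  apply/matrixP => i0 i; rewrite !mxE.
  have [_ /(_ w l y hy)] := hc (enum_val i); rewrite hFa => hrow.
  apply: (@etrans _ _ (a * mon y (bm (enum_val i)) -
    \sum_g ev2 w l (c (enum_val i) g) * mon y (bm g))); last by rewrite hrow subrr.
  rewrite [in RHS](reindex (@enum_val _ box)) /=; last by apply: onW_bij; exact: enum_val_bij.
  rewrite (eq_bigr (fun j => (i == j)%:R * a * mon y (bm (enum_val j)) -
    ev2 w l (c (enum_val i) (enum_val j)) * mon y (bm (enum_val j)))); last first.
    move=> j _; rewrite !mxE /= /horner_eval /ev2 hornerD hornerN hornerD hornerN mulrC -mulrBl; congr (_ * _).
    by case: (i == j); rewrite ?mulr1n ?mulr0n ?hornerC ?mul1r ?mul0r ?horner0.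
  rewrite sumrB; congr (_ - _); rewrite (bigD1 i) //= eqxx mul1r big1 ?addr0 // => j ji.
  by rewrite eq_sym (negPf ji) !mul0r.
Qed.

End Elimination.

(** * Newton polygon estimate *)

Section Newton.
Variable R : rcfType.

Lemma horner_growth (p : {poly R}) : p != 0 -> exists al be W : R,
  [/\ 0 < al, 0 < be, 1 <= W & forall w, W <= w ->
    al * w ^+ (size p).-1 <= `|p.[w]| /\ `|p.[w]| <= be * w ^+ (size p).-1].
Proof.
move=> p0; set d := (size p).-1.
have sp : size p = d.+1 by rewrite prednK // size_poly_gt0.
pose S := \sum_(i < d) `|p`_i|.
have S0 : 0 <= S by apply: sumr_ge0.
have lc : 0 < `|p`_d| by rewrite normr_gt0 -lead_coefE lead_coef_eq0.
have q0 : 0 <= 2%:R * S / `|p`_d| by apply: divr_ge0 => //; apply: mulr_ge0.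
(* [W] is large enough for the lower terms to amount to at most half of the leading one. *)
exists (`|p`_d| / 2%:R), (S + `|p`_d|), (1 + 2%:R * S / `|p`_d|); split; [lra|lra| |].
  by rewrite lerDl.
move=> w hw.
have w1 : 1 <= w by apply: le_trans hw; rewrite lerDl.
have w0 : 0 <= w by lra.
have pE : p.[w] = \sum_(i < d) p`_i * w ^+ i + p`_d * w ^+ d.
  by rewrite horner_coef sp big_ord_recr.
have wd : 0 <= w ^+ d by apply: exprn_ge0.
have lowE : `|\sum_(i < d) p`_i * w ^+ i| * w <= S * w ^+ d.
  rewrite /S mulr_suml; apply: le_trans (ler_wpM2r w0 (ler_norm_sum _ _ _)) _.
  rewrite mulr_suml; apply: ler_sum => i _.
  rewrite normrM normrX (ger0_norm w0) -mulrA -exprSr ler_wpM2l //.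
  by apply: ler_weXn2l.
have low1 : `|\sum_(i < d) p`_i * w ^+ i| <= S * w ^+ d.
  by apply: le_trans lowE; rewrite ler_peMr.
have topE : `|p`_d * w ^+ d| = `|p`_d| * w ^+ d by rewrite normrM (ger0_norm wd).
split; last first.
  by rewrite pE mulrDl -topE; apply: le_trans (ler_normD _ _) (lerD low1 (lexx _)).
have h2 : 2%:R * S <= `|p`_d| * w.
  have : 2%:R * S / `|p`_d| <= w by lra.
  by rewrite ler_pdivrMr // [w * _]mulrC.
set X := \sum_(i < d) _ in pE lowE low1.
have h3 : 2%:R * `|X| <= `|p`_d| * w ^+ d.
  have wp : 0 < w by lra.
  rewrite -(ler_pM2r wp); have : 2%:R * S * w ^+ d <= `|p`_d| * w * w ^+ d by apply: ler_wpM2r.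
  by move: lowE; rewrite -!mulrA (mulrC w (w ^+ d)); lra.
have : `|p`_d| * w ^+ d <= `|p.[w]| + `|X|.
  rewrite -topE; have -> : p`_d * w ^+ d = p.[w] - X by rewrite pE; ring.
  exact: ler_normB.
lra.
Qed.

Lemma horner_growth_seq (s : seq {poly R}) : exists al be W : R,
  [/\ 0 < al, 0 < be, 1 <= W & forall p, p \in s -> p != 0 -> forall w, W <= w ->
    al * w ^+ (size p).-1 <= `|p.[w]| /\ `|p.[w]| <= be * w ^+ (size p).-1].
Proof.
elim: s => [|p s [al [be [W [al0 be0 W1 IH]]]]]; first by exists 1, 1, 1.
case: (eqVneq p 0) => p0.
  exists al, be, W; split=> // q; rewrite inE => /orP[/eqP ->|/IH //].
  by rewrite p0 eqxx.
have [al' [be' [W' [al'0 be'0 W'1 h]]]] := horner_growth p0.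
exists (Num.min al al'), (Num.max be be'), (Num.max W W'); split.
- by rewrite lt_min al0.
- by rewrite lt_max be0.
- by rewrite le_max W1.
move=> q qs q0 w; rewrite ge_max => /andP[hW hW'].
have wq : 0 <= w ^+ (size q).-1 by apply: exprn_ge0; lra.
have [h1 h2] : exists a b, [/\ Num.min al al' <= a, b <= Num.max be be',
    a * w ^+ (size q).-1 <= `|q.[w]| & `|q.[w]| <= b * w ^+ (size q).-1].
  move: qs; rewrite inE => /orP[/eqP qp|qs].
    exists al', be'; rewrite ge_min lexx orbT le_max lexx orbT qp.
    by have [] := h w hW'.
  exists al, be; rewrite ge_min lexx le_max lexx.
  by have [] := IH q qs q0 w hW.
case: h2 => b [m1 m2 m3 m4]; split.
  by apply: le_trans m3; apply: ler_wpM2r.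
by apply: le_trans m4 _; apply: ler_wpM2r.
Qed.

(** If every other term were smaller than the largest by more than the factor [s], the remaining
    [s - 1] terms could not cancel it. *)
Lemma two_dominant (s : nat) (t : 'I_s -> R) : (exists i, t i != 0) -> \sum_i t i = 0 ->
  exists i j : 'I_s, [/\ (i < j)%N, t i != 0, t j != 0,
    `|t i| <= s%:R * `|t j| & `|t j| <= s%:R * `|t i|].
Proof.
move=> [i0 ti0] t0.
have s0 : (0 < s)%N by apply: leq_ltn_trans (ltn_ord i0).
pose j := [arg max_(i > i0) `|t i|]%O.
have hj i : `|t i| <= `|t j| by rewrite /j; case: arg_maxP => // k _ /(_ i isT).
have tj : 0 < `|t j| by apply: lt_le_trans (hj i0); rewrite normr_gt0.
have s1 : 1 <= s%:R :> R by rewrite ler1n.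
have [i ij hi] : exists2 i, i != j & `|t j| <= s%:R * `|t i|.
  apply: NNPP => no.
  have hs i : i != j -> s%:R * `|t i| < `|t j|.
    by move=> ij; rewrite ltNge; apply/negP => h; apply: no; exists i.
  have : `|t j| <= \sum_(i | i != j) `|t i|.
    move: t0; rewrite (bigD1 j) //= => /eqP; rewrite addr_eq0 => /eqP ->.
    by rewrite normrN; apply: ler_norm_sum.
  apply/negP; rewrite -ltNge.
  have sp : 0 < s%:R :> R by rewrite ltr0n.
  rewrite -(ltr_pM2l sp) mulr_sumr.
  apply: le_lt_trans (_ : \sum_(i | i != j) `|t j| < _).
    by apply: ler_sum => i /hs /ltW.
  rewrite sumr_const -(mulr_natl `|t j|) ltr_pM2r // ltr_nat.
  have -> : #|[pred i | i != j]| = s.-1 by rewrite cardC1 card_ord.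
  by rewrite ltn_predL.
have ti : t i != 0.
  by apply: contraTneq hi => ->; rewrite normr0 mulr0 -ltNge.
have hij : `|t i| <= s%:R * `|t j|.
  by apply: le_trans (hj i) _; rewrite ler_peMl.
have tj0 : t j != 0 by rewrite -normr_gt0.
case: (ltngtP i j) => [lt|gt|/val_inj eq].
- by exists i, j.
- by exists j, i.
- by rewrite eq eqxx in ij.
Qed.

(** Two comparable terms of [chi], of degrees [i < j] in [l], balance [l ^+ q] with [q = j - i]
    against an integer power of [w]. Its exponent is at most [2 q - 1] or at least [2 q], and this
    gap between integers gives the two alternatives. *)
Lemma newton_slopes (chi : {poly {poly R}}) : chi != 0 -> exists C W : R,
  [/\ 0 < C, 1 <= W & forall w l, W <= w -> 0 < l -> ev2 w l chi = 0 ->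
    exists q, [/\ (0 < q)%N, (q < size chi)%N &
      l ^+ q <= C * w ^+ (2 * q).-1 \/ w ^+ (2 * q) <= C * l ^+ q]].
Proof.
move=> chi0; set s := size chi.
have [al [be [W [al0 be0 W1 hW]]]] := horner_growth_seq chi.
have s0 : (0 < s)%N by rewrite size_poly_gt0.
have sR : 0 < s%:R :> R by rewrite ltr0n.
exists (s%:R * be / al), W; split=> //; first by rewrite divr_gt0 ?mulr_gt0.
move=> w l wW l0; rewrite /ev2 (horner_coef chi) horner_sum -/s.
have w0 : 0 < w by lra.
have w1 : 1 <= w by lra.
under eq_bigr do rewrite hornerM -polyC_exp hornerC.
set t := fun i : 'I_s => (chi`_i).[w] * l ^+ i.
have hc (i : 'I_s) : chi`_i != 0 -> al * w ^+ (size chi`_i).-1 * l ^+ i <= `|t i| /\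
    `|t i| <= be * w ^+ (size chi`_i).-1 * l ^+ i.
  move=> ci; have [h1 h2] := hW _ (mem_nth 0 (ltn_ord i)) ci w wW.
  have li : 0 <= l ^+ i by rewrite exprn_ge0 ?ltW.
  by rewrite /t normrM (ger0_norm li); split; apply: ler_wpM2r.
move=> sum0; have [|i [j [ij ti tj h1 h2]]] := two_dominant _ sum0.
  have sl : (s.-1 < s)%N by rewrite ltn_predL.
  exists (Ordinal sl).
  have lc : chi`_(Ordinal sl) != 0 by rewrite /= -lead_coefE lead_coef_eq0.
  rewrite -normr_gt0; have [h _] := hc (Ordinal sl) lc; apply: lt_le_trans h.
  by rewrite !mulr_gt0 ?exprn_gt0.
have ci : chi`_i != 0 by apply: contraNneq ti; rewrite /t => ->; rewrite horner0 mul0r.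
have cj : chi`_j != 0 by apply: contraNneq tj; rewrite /t => ->; rewrite horner0 mul0r.
have [a1 a2] := hc i ci; have [b1 b2] := hc j cj.
set ai := (size chi`_i).-1 in a1 a2; set aj := (size chi`_j).-1 in b1 b2.
set C := s%:R * be / al.
have alN : al != 0 by rewrite gt_eqF.
have cmp (x y X Y : R) : al * X <= x -> x <= s%:R * y -> y <= be * Y -> X <= C * Y.
  move=> hx hxy hy; rewrite -(ler_pM2l al0); apply: le_trans hx _; apply: le_trans hxy _.
  have -> : al * (C * Y) = s%:R * (be * Y) by rewrite /C; field.
  by apply: ler_wpM2l => //; exact: ltW.
have r1 : w ^+ aj * l ^+ j <= C * (w ^+ ai * l ^+ i).
  by apply: (cmp `|t j| `|t i|) => //; rewrite mulrA.
have r2 : w ^+ ai * l ^+ i <= C * (w ^+ aj * l ^+ j).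
  by apply: (cmp `|t i| `|t j|) => //; rewrite mulrA.
exists (j - i)%N; rewrite subn_gt0 ij; split=> //.
  by apply: leq_ltn_trans (leq_subr _ _) (ltn_ord j).
set q := (j - i)%N; have jE : (j = q + i :> nat)%N by rewrite subnK // ltnW.
have q0 : (0 < q)%N by rewrite subn_gt0.
have C0 : 0 < C by rewrite divr_gt0 ?mulr_gt0.
have li : 0 < l ^+ i by rewrite exprn_gt0.
have waj : 0 < w ^+ aj by rewrite exprn_gt0.
rewrite jE exprD in r1 r2.
case: (leqP ai (aj + (2 * q).-1)) => hd.
  left; rewrite -(ler_pM2r li) -(ler_pM2l waj); apply: le_trans r1 _.
  have -> : w ^+ aj * (C * w ^+ (2 * q).-1 * l ^+ i) = C * (w ^+ (aj + (2 * q).-1) * l ^+ i).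
    by rewrite exprD; ring.
  by rewrite ler_pM2l // ler_pM2r // ler_weXn2l.
right; rewrite -(ler_pM2r li) -(ler_pM2l waj).
have -> : w ^+ aj * (C * l ^+ q * l ^+ i) = C * (w ^+ aj * (l ^+ q * l ^+ i)) by ring.
apply: le_trans r2; rewrite mulrA -exprD ler_pM2r // ler_weXn2l //.
by move: hd; rewrite -ltnS -addnS prednK // muln_gt0.
Qed.

End Newton.

(** * The gradient inequality *)

Section GradientInequality.
Variables (R : rcfType) (n : nat).
Implicit Types (f p : {mpoly R[n]}) (y : 'I_n -> R).

Lemma mderiv_exp i p k : (p ^+ k.+1)^`M(i) = k.+1%:R *: (p ^+ k * p^`M(i)).
Proof.
elim: k => [|k IH]; first by rewrite expr1 expr0 mul1r scale1r.
rewrite exprS mderivM IH -scalerAr mulrA -exprS [p^`M(i) * _]mulrC.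
by rewrite -[k.+2%:R]natr1 scalerDl scale1r addrC.
Qed.

Lemma msize_mderiv_le i p : (msize p^`M(i) <= msize p)%N.
Proof.
rewrite [X in (X <= _)%N]msizeE; apply/bigmax_leqP_seq => m hm _.
have : (m + U_(i))%MM \in msupp p.
  rewrite mcoeff_msupp; apply: contraTneq hm => h.
  by rewrite -mcoeff_eq0 mcoeff_mderiv h mul0rn.
by move=> /msize_mdeg_lt; rewrite mdegD mdeg1 addn1; apply: leq_trans.
Qed.

Definition gradsq f y : R := \sum_i (f^`M(i)).@[y] ^+ 2.

Lemma gradsq_ge0 f y : 0 <= gradsq f y.
Proof. by apply: sumr_ge0 => i _; apply: sqr_ge0. Qed.

Lemma gradsq_ge f y i : (f^`M(i)).@[y] ^+ 2 <= gradsq f y.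
Proof. by rewrite /gradsq (bigD1 i) //= lerDl sumr_ge0 // => j _; apply: sqr_ge0. Qed.

(** Raising the hypothesis to the power [N] and extracting a [q]-th root makes the exponent
    independent of [q]. It rests on [(2 q - 1) N <= (2 N - 1) q] and [v <= 1]. *)
Lemma exponent_raise (v g C : R) (q N : nat) : 0 < v -> v <= 1 -> 0 <= g -> 1 <= C ->
  (0 < q)%N -> (q <= N)%N -> v ^+ (2 * q).-1 <= C * g ^+ q ->
  v ^+ (2 * N).-1 <= C ^+ N * g ^+ N.
Proof.
move=> v0 v1 g0 C1 q0 qN h.
have C0 : 0 <= C by lra.
have vg0 := ltW v0.
have hq : (0 < q)%N by [].
rewrite -(@ler_pXn2r _ q) ?nnegrE ?exprn_ge0 ?mulr_ge0 ?exprn_ge0 //.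
rewrite -exprM exprMn -!exprM.
apply: (@le_trans _ _ (v ^+ ((2 * q).-1 * N))).
  apply: ler_wiXn2l => //.
  rewrite -!subn1 !mulnBl !mul1n mulnAC; exact: leq_sub2l.
rewrite exprM; apply: (@le_trans _ _ ((C * g ^+ q) ^+ N)).
  by rewrite ler_pXn2r ?nnegrE ?exprn_ge0 ?mulr_ge0 ?exprn_ge0 ?(leq_trans q0 qN).
rewrite exprMn -exprM [(q * N)%N]mulnC ler_wpM2r ?exprn_ge0 //.
by apply: ler_weXn2l => //; rewrite leq_pmulr.
Qed.

(** The degree bound of [critical_value_eqn] for [k = 2 D + 1] and a penalty of degree [k + 1] in
    [y]. *)
Definition loj_exp (D : nat) := ((2 * D).+1 ^ n * (1 + ((2 * D).+2 + n * (2 * D).+1)))%N.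

Section Fixed.
Variables (D : nat) (f : {mpoly R[n]}) (c : R).
Hypotheses (sf : (msize f <= D.+1)%N) (c0 : 0 < c).
Let k := (2 * D).+1.

Definition penalty (w l : R) : {mpoly R[n]} :=
  (w *: f - 1) ^+ 2 + l *: \sum_j (f^`M(j)) ^+ 2 + c *: \sum_j 'X_j ^+ k.+1.

(** The part of the penalty free of [l]. The exponent [k.+1 = 2 D + 2] is even, so both summands are
    nonnegative. *)
Definition conf (w : R) (y : 'I_n -> R) := (w * f.@[y] - 1) ^+ 2 + c * \sum_j y j ^+ k.+1.

Lemma meval_sumXn y e : (\sum_j 'X_j ^+ e : {mpoly R[n]}).@[y] = \sum_j y j ^+ e.
Proof. by rewrite raddf_sum /=; apply: eq_bigr => j _; rewrite rmorphXn /= mevalXU. Qed.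

Lemma penaltyE w l y : (penalty w l).@[y] = conf w y + l * gradsq f y.
Proof.
have hg : (\sum_j (f^`M(j)) ^+ 2).@[y] = gradsq f y.
  by rewrite raddf_sum /=; apply: eq_bigr => j _; rewrite rmorphXn.
rewrite /penalty /conf !(mevalD, mevalZ) hg meval_sumXn rmorphXn /= mevalB mevalZ meval1.
ring.
Qed.

(** The critical equation for coordinate [i], solved for [y i ^+ k]; the degree [2 D] in [y] is
    below [k]. *)
Let gradG (i : 'I_n) (w l : R) (y : 'I_n -> R) :=
  - (c * k.+1%:R)^-1 * ((2%:R * w) * ((w * f.@[y] + -1) * (f^`M(i)).@[y]) +
     2%:R * l * \sum_j (f^`M(j)).@[y] * (f^`M(j)^`M(i)).@[y]).

Lemma penalty_crit w l y : (forall i, ((penalty w l)^`M(i)).@[y] = 0) -> solves k gradG w l y.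
Proof.
move=> hy i; have := hy i.
have d1 : (1 : {mpoly R[n]})^`M(i) = 0 by rewrite -mpolyC1 mderivC.
have hg : ((\sum_j (f^`M(j)) ^+ 2)^`M(i)).@[y] =
    2%:R * \sum_j (f^`M(j)).@[y] * (f^`M(j)^`M(i)).@[y].
  rewrite (raddf_sum (mderiv i)) (raddf_sum (meval y)) mulr_sumr; apply: eq_bigr => j _ /=.
  by rewrite mderiv_exp mevalZ expr1 mevalM.
have hX : ((\sum_j 'X_j ^+ k.+1 : {mpoly R[n]})^`M(i)).@[y] = k.+1%:R * y i ^+ k.
  rewrite (raddf_sum (mderiv i)) (raddf_sum (meval y)) (bigD1 i) //= big1 ?addr0 => [|j ji].
    rewrite mderiv_exp mevalZ mevalM rmorphXn /= mevalXU mderivX mnm1E eqxx scale1r.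
    have -> : (U_(i) - U_(i))%MM = 0%MM :> 'X_{1..n}.
      by apply/mnmP => j; rewrite mnmBE subnn mnm0E.
    by rewrite mpolyX0 meval1 mulr1.
  by rewrite mderiv_exp mderivX mnm1E (negPf ji) scale0r mulr0 scaler0 meval0.
rewrite /penalty !(mderivD, mderivZ) mderiv_exp !(mevalD, mevalZ) expr1 mevalM mevalB mevalZ meval1.
rewrite mderivB mderivZ d1 subr0 mevalZ hg hX /gradG.
set S := \sum_j _; set Y := y i ^+ k; move=> h.
have k0 : k.+1%:R != 0 :> R by rewrite pnatr_eq0.
have cN : c != 0 by rewrite gt_eqF.
set X := _ + _; have hY : c * k.+1%:R * Y = - X.
  by apply/eqP; rewrite -addr_eq0 -h; apply/eqP; rewrite /X; ring.
by rewrite mulNr -mulrN -hY mulKf // mulf_neq0.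
Qed.

Lemma tf_gradG i : tf (2 * D) 1 (gradG i).
Proof.
have sd j : (msize f^`M(j) <= D.+1)%N by apply: leq_trans (msize_mderiv_le _ _) sf.
have sdd j : (msize f^`M(j)^`M(i) <= D.+1)%N by apply: leq_trans (msize_mderiv_le _ _) (sd j).
have hf := tfD (tf_weak (leq0n D) (leqnn 0) (@tfC R n (-1)))
  (tf_weak (leqnn D) (leqnn 0) (tfM (@tf_w R n) (tf_mpoly sf))).
have h1 := tfM (tfM (@tfC R n 2%:R) (@tf_w R n)) (tfM hf (tf_mpoly (sd i))).
have h2 := tfM (tfM (@tfC R n 2%:R) (@tf_l R n))
  (tf_sum (index_enum 'I_n) (fun j => tfM (tf_mpoly (sd j)) (tf_mpoly (sdd j)))).
have h3 := tfM (@tfC R n (- (c * k.+1%:R)^-1)) (tfD (tf_weak (leqnn _) (leq0n 1) h1) h2).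
apply: tf_ext (tf_weak _ _ h3); last 2 first.
- by rewrite !add0n addnn mul2n.
- by [].
by move=> w l y; rewrite /gradG [-1 + _]addrC.
Qed.

Lemma tf_penalty : tf k.+1 1 (fun w l y => (penalty w l).@[y]).
Proof.
have sd j : (msize f^`M(j) <= D.+1)%N by apply: leq_trans (msize_mderiv_le _ _) sf.
have hf := tfD (tf_weak (leq0n D) (leqnn 0) (@tfC R n (-1)))
  (tf_weak (leqnn D) (leqnn 0) (tfM (@tf_w R n) (tf_mpoly sf))).
have h2 := tfM (@tf_l R n) (tf_sum (index_enum 'I_n) (fun j => tfM (tf_mpoly (sd j)) (tf_mpoly (sd j)))).
have sX : (msize (\sum_j 'X_j ^+ k.+1 : {mpoly R[n]}) <= k.+2)%N.
  apply: leq_trans (msize_sum _ _ _) _; apply/bigmax_leqP => j _.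
  by rewrite mpolyXn msizeX mdegMn mdeg1 mul1n.
have h3 := tfM (@tfC R n c) (tf_mpoly sX).
have w1 : (D + D <= k.+1)%N by rewrite addnn -mul2n /k !leqW.
apply: tf_ext (tfD (tf_weak w1 (leq0n 1) (tfM hf hf))
  (tfD (tf_weak w1 (leqnn 1) h2) (tf_weak (leqnn _) (leq0n 1) h3))).
move=> w l y; rewrite penaltyE /conf meval_sumXn.
have -> : \sum_j (f^`M(j)).@[y] * (f^`M(j)).@[y] = gradsq f y.
  by apply: eq_bigr => j _; rewrite expr2.
ring.
Qed.

End Fixed.

Lemma df_meval p : df (fun e => p.@[fun i : 'I_n => e i]).
Proof. by apply/df_pfun/pfun_meval => i; exact: pfun_var. Qed.

Lemma df_gradsq f : df (fun e => gradsq f (fun i : 'I_n => e i)).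
Proof. by apply: df_sum => i; apply: dfX; exact: df_meval. Qed.

Lemma cont_gradsq f y : cont_at (gradsq f) y.
Proof. by apply: cont_sum => i; apply: contX; exact: cont_meval. Qed.

Lemma df_conf D f c w : df (fun e => conf D f c w (fun i : 'I_n => e i)).
Proof.
apply: dfD; first apply: dfX; df_tac; first exact: df_meval.
by apply: df_sum => i; df_tac.
Qed.

Lemma cont_conf D f c w y : cont_at (conf D f c w) y.
Proof.
apply: contD.
  apply: contX; apply: contD; last exact: cont_cst.
  by apply: contM; [exact: cont_cst|exact: cont_meval].
apply: contM; first exact: cont_cst.
by apply: cont_sum => i; apply: contX; exact: cont_coord.
Qed.

(* [l] is the largest parameter for which [penalty w l] takes a value [<= a]. *)
Lemma max_penalty D f c w a y0 B : 0 < c -> boundedS (fun y => conf D f c w y <= a) B ->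
  conf D f c w y0 < a -> (exists2 m, 0 < m & forall y, conf D f c w y <= a -> m <= gradsq f y) ->
  exists l y, [/\ (a - conf D f c w y0) / gradsq f y0 <= l, conf D f c w y <= a,
    l * gradsq f y = a - conf D f c w y & forall i, ((penalty D f c w l)^`M(i)).@[y] = 0].
Proof.
move=> c0 hB hy0 [m m0 hm].
set A := fun y => conf D f c w y <= a in hB hm.
have g0 y : A y -> 0 < gradsq f y by move=> /hm; apply: lt_le_trans.
have [|||||||y Ay hy] := @extreme_value _ _ A
    (fun y => - ((a - conf D f c w y) * (gradsq f y)^-1)) B.
- by apply: sa_le; [exact: df_conf|exact: df_cst].
- apply/dfN/dfM; last by apply/df_inv/df_gradsq.
  by apply: dfD; [exact: df_cst|apply/dfN/df_conf].
- by apply: closed_le => p; [exact: cont_conf|exact: cont_cst].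
- exact: hB.
- move=> p Ap; apply/contN/contM.
    by apply: contD; [exact: cont_cst|apply/contN/cont_conf].
  by apply: cont_inv; [rewrite gt_eqF // g0|exact: cont_gradsq].
- by exists y0; exact: ltW.
- exists (- (a * m^-1)) => y Ay; rewrite lerN2.
  have cge : 0 <= conf D f c w y.
    rewrite addr_ge0 ?sqr_ge0 // mulr_ge0 ?(ltW c0) //; apply: sumr_ge0 => i _.
    by rewrite exprn_even_ge0 //= mul2n odd_double.
  have gp := g0 y Ay; rewrite /A in Ay.
  apply: ler_pM; rewrite ?subr_ge0 ?invr_ge0 ?(ltW gp) //; first by lra.
  by rewrite lef_pV2 ?posrE // hm.
have gy := g0 y Ay.
exists ((a - conf D f c w y) / gradsq f y), y; split=> //.
- by have := hy y0 (ltW hy0); rewrite lerN2.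
- by rewrite divfK // gt_eqF.
set l := _ / _; have l0 : 0 <= l by rewrite divr_ge0 ?subr_ge0 ?(ltW gy).
(* By maximality of [l] the penalty is at least [a] everywhere and equals [a] at [y]; the minimum is
   global and any radius would do. *)
apply: (@local_min_grad _ _ _ _ 1) => // z _; rewrite !penaltyE /l divfK ?gt_eqF // addrC subrK -/l.
case: (lerP (conf D f c w z) a) => hz; last first.
  by have := mulr_ge0 l0 (gradsq_ge0 f z); lra.
have := hy z hz; rewrite lerN2 -/l ler_pdivrMr ?g0 //; lra.
Qed.

Lemma gradient_ineq D f (B : R) : (msize f <= D.+1)%N -> 0 <= B ->
  exists c eta : R, [/\ 0 < c, 0 < eta & forall y, (forall i, `|y i| <= B) ->
    0 < f.@[y] -> f.@[y] < eta ->
    c * f.@[y] ^+ (2 * loj_exp D).-1 <= gradsq f y ^+ loj_exp D].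
Proof.
move=> sf B0; set N := loj_exp D; pose K := (2 * D).+2.
have evK : ~~ odd K by rewrite /K /= mul2n odd_double.
pose P := n.+1%:R * (B + 1) ^+ K.
have P0 : 0 < P by rewrite mulr_gt0 ?ltr0n // exprn_gt0; lra.
(* With this [c] the coordinate penalty is at most [1 / 16] on the box of size [B]. *)
pose c := (16%:R * P)^-1.
have c0 : 0 < c by rewrite invr_gt0 mulr_gt0.
have cP : c * P = 16%:R^-1 by rewrite /c; field; rewrite gt_eqF.
(* Above [1 / 8], [a] leaves slack [1 / 16] at [y0]; below [1 / 4], [conf <= a] forces [w * f]
   between [1 / 2] and [3 / 2]. *)
have [|a /andP[a1 a2] [chi [chi0 schi hchi]]] := critical_value_eqn (leqnn _) (tf_gradG c sf)
    (a0 := 8%:R^-1) (a1 := 4%:R^-1) (tf_penalty c sf).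
  by rewrite ltf_pV2 ?posrE ?ltr_nat ?ltr0n.
have [C [W [C0 W1 hW]]] := newton_slopes chi0.
(* [T] exceeds [C] in order to refute the second Newton alternative; the box of size [B'] contains
   every point with [conf <= a]. *)
pose T := 1 + C; pose B' := B + 1 + c^-1.
have T0 : 0 < T by rewrite /T; lra.
have c'0 : 0 < c^-1 by rewrite invr_gt0.
have B'0 : 0 <= B' by rewrite /B'; lra.
have [eta1 eta10 hgd] := gradient_dominates f B'0 T0.
(* These bounds give [v <= 1], [W <= w] and, since [f < 3 v / 2] where [conf <= a], also [f < eta1]
   there. *)
pose eta := Num.min (Num.min 1 W^-1) (eta1 / 2%:R).
have W0 : 0 < W by lra.
have eta0 : 0 < eta by rewrite /eta !lt_min ltr01 invr_gt0 W0 divr_gt0.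
pose C' := (1 + C) * 16%:R ^+ N.
have C'1 : 1 <= C'.
  rewrite /C'; have : 1 <= 16%:R ^+ N :> R by rewrite exprn_ege1 // ler1n.
  by move=> h; apply: (le_trans h); rewrite ler_peMl ?(le_trans ler01 h) //; lra.
have C'0 : 0 < C' by lra.
exists ((C' ^+ N)^-1), eta; split=> //; first by rewrite invr_gt0 exprn_gt0.
move=> y0 hy0 f0 f1; set v := f.@[y0] in f0 f1 *.
move: f1; rewrite !lt_min => /andP[/andP[v1 vW] veta].
pose w := v^-1.
have w0 : 0 < w by rewrite invr_gt0.
have wv : w * v = 1 by rewrite mulVf // gt_eqF.
have wW : W <= w by rewrite -[W]invrK lef_pV2 ?posrE ?invr_gt0 // ltW.
have gbig y : conf D f c w y <= a -> (forall i, `|y i| <= B') /\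
    T ^+ 2 <= 4%:R * w ^+ 2 * gradsq f y.
  move=> hy.
  have yK i : 0 <= y i ^+ K by rewrite exprn_even_ge0.
  have s1 : 0 <= (w * f.@[y] - 1) ^+ 2 := sqr_ge0 _.
  have s2 : 0 <= c * \sum_j y j ^+ K by rewrite mulr_ge0 ?(ltW c0) //; apply: sumr_ge0.
  have hc1 : (w * f.@[y] - 1) ^+ 2 < 4%:R^-1 by move: hy; rewrite /conf -/K; lra.
  have hc2 : c * \sum_j y j ^+ K < 4%:R^-1 by move: hy; rewrite /conf -/K; lra.
  have yB i : `|y i| <= B'.
    case: (lerP `|y i| 1) => y1; first by rewrite /B'; lra.
    have : `|y i| <= `|y i| ^+ K by apply: ler_eXnr => //; exact: ltW.
    rewrite -normrX (ger0_norm (yK i)) => h; apply: le_trans h _.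
    have : c * y i ^+ K <= c * \sum_j y j ^+ K.
      by rewrite ler_pM2l // (bigD1 i) //= lerDl sumr_ge0.
    move=> h; have : c * y i ^+ K <= 1 by lra.
    by rewrite mulrC -ler_pdivlMr // mul1r /B'; lra.
  have hwf : 2%:R^-1 < w * f.@[y] < 3%:R / 2%:R.
    set x := w * f.@[y] in hc1 *.
    have : (x - 1) ^+ 2 < (2%:R^-1) ^+ 2 by rewrite exprVn -natrX.
    rewrite -[(x - 1) ^+ 2]real_normK ?num_real // ltr_pXn2r ?nnegrE ?invr_ge0 //.
    by rewrite ltr_norml => /andP[h1 h2]; apply/andP; split; lra.
  case/andP: hwf => hw1 hw2.
  have fy0 : 0 < f.@[y] by rewrite -(pmulr_rgt0 _ w0); apply: lt_trans hw1; rewrite invr_gt0.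
  have fy1 : f.@[y] < eta1.
    have : v * (w * f.@[y]) < v * (3%:R / 2%:R) by rewrite ltr_pM2l.
    by rewrite mulrA [v * w]mulrC wv mul1r; lra.
  split=> //; have [i hi] := hgd y yB fy0 fy1.
  have h1 : (T * f.@[y]) ^+ 2 <= gradsq f y.
    apply: le_trans (gradsq_ge f y i).
    rewrite -[(f^`M(i)).@[y] ^+ 2]real_normK ?num_real //.
    by rewrite ler_pXn2r ?nnegrE ?(ltW hi) // ltW // mulr_gt0.
  have h2 : 1 <= 4%:R * (w * f.@[y]) ^+ 2.
    set x := w * f.@[y] in hw1 *; nra.
  apply: (@le_trans _ _ (4%:R * w ^+ 2 * (T * f.@[y]) ^+ 2)).
    have -> : 4%:R * w ^+ 2 * (T * f.@[y]) ^+ 2 = T ^+ 2 * (4%:R * (w * f.@[y]) ^+ 2) by ring.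
    by rewrite ler_peMr // exprn_ge0 // ltW.
  by apply: ler_wpM2l => //; rewrite mulr_ge0 // exprn_ge0 // ltW.
have conf0 : conf D f c w y0 <= 16%:R^-1.
  rewrite /conf -/v wv subrr expr0n add0r -cP ler_pM2l // /P -/K.
  apply: (@le_trans _ _ (\sum_(j < n) (B + 1) ^+ K)).
    apply: ler_sum => j _; rewrite -[_ ^+ _]ger0_norm ?exprn_even_ge0 // normrX.
    by rewrite ler_pXn2r ?nnegrE //; have := hy0 j; lra.
  by rewrite sumr_const card_ord -[X in X <= _]mulr_natl ler_wpM2r ?ler_nat // exprn_ge0; lra.
have [//|||l [y [hl1 hl2 hl3 hl4]]] := @max_penalty D f c w a y0 B' c0.
- by move=> y /gbig[].
- by apply: le_lt_trans conf0 _; lra.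
- exists (T ^+ 2 / (4%:R * w ^+ 2)); first by rewrite divr_gt0 ?mulr_gt0 ?exprn_gt0.
  move=> y /gbig[_ h]; rewrite ler_pdivrMr 1?mulrC //.
  by rewrite mulr_gt0 ?exprn_gt0.
have [|_ g00] := gbig y0; first by lra.
have g0 : 0 < gradsq f y0.
  rewrite lt_neqAle gradsq_ge0 andbT; apply/eqP => h; move: g00; rewrite -h mulr0.
  by apply/negP; rewrite -ltNge exprn_gt0.
have l16 : (16%:R * gradsq f y0)^-1 <= l.
  apply: le_trans hl1; rewrite invfM ler_pM2r ?invr_gt0 //; lra.
have l0 : 0 < l by apply: lt_le_trans l16; rewrite invr_gt0 mulr_gt0.
have [|q [q0 qs hq]] := hW w l wW l0.
  apply: (hchi w l y); first exact: penalty_crit.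
  by rewrite penaltyE hl3; lra.
have qN : (q <= N)%N by rewrite -ltnS; apply: leq_trans qs schi.
(* In the other alternative, [l * gradsq f y < 1 / 4] and the lower bound on the gradient at [y]
   give [l * T ^+ 2 <= w ^+ 2], whence [T ^+ (2 * q) <= C], against [T = 1 + C]. *)
have hq1 : l ^+ q <= C * w ^+ (2 * q).-1.
  case: hq => // hq; exfalso.
  have [_ hT] := gbig y hl2.
  have lT : l * T ^+ 2 <= w ^+ 2.
    apply: (@le_trans _ _ (l * (4%:R * w ^+ 2 * gradsq f y))); first by rewrite ler_pM2l.
    have -> : l * (4%:R * w ^+ 2 * gradsq f y) = w ^+ 2 * (4%:R * (l * gradsq f y)) by ring.
    rewrite hl3 ger_pMr ?exprn_gt0 //.
    have : 0 <= conf D f c w y.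
      rewrite addr_ge0 ?sqr_ge0 // mulr_ge0 ?(ltW c0) //; apply: sumr_ge0 => i _.
      by rewrite exprn_even_ge0.
    lra.
  have : (l * T ^+ 2) ^+ q <= (w ^+ 2) ^+ q.
    by rewrite ler_pXn2r ?nnegrE ?mulr_ge0 ?exprn_ge0 ?(ltW l0) ?(ltW T0) ?(ltW w0).
  rewrite -exprM => h; have {h} := le_trans h hq.
  rewrite exprMn [C * _]mulrC ler_pM2l ?exprn_gt0 // -exprM => h.
  have T1 : 1 <= T by rewrite /T; lra.
  have : T <= T ^+ (2 * q) by apply: ler_eXnr => //; rewrite muln_gt0.
  rewrite /T in h *; lra.
(* Since [l] is at least of order [1 / gradsq f y0], its upper bound in [w = 1 / v] becomes a lower
   bound on the gradient at [y0]. *)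
have hq2 : v ^+ (2 * q).-1 <= C' * gradsq f y0 ^+ q.
  have : ((16%:R * gradsq f y0)^-1) ^+ q <= C * w ^+ (2 * q).-1.
    apply: le_trans hq1; rewrite ler_pXn2r ?nnegrE ?(ltW l0) // invr_ge0 mulr_ge0 //.
    exact: ltW.
  rewrite /w !exprVn ler_pdivlMr ?exprn_gt0 // mulrC ler_pdivrMr ?exprn_gt0 ?mulr_gt0 //.
  move=> h; apply: le_trans h _; rewrite exprMn mulrA ler_wpM2r ?exprn_ge0 ?gradsq_ge0 //.
  rewrite /C'; apply: ler_pM; [exact: ltW|by rewrite exprn_ge0|lra|].
  by rewrite ler_weXn2l // ler1n.
have := exponent_raise f0 (ltW v1) (ltW g0) C'1 q0 qN hq2.
by move=> h; rewrite mulrC ler_pdivrMr ?exprn_gt0 // mulrC.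
Qed.

End GradientInequality.

(** * The error bound *)

Section ErrorBound.
Variables (R : rcfType) (n r s : nat) (g : 'I_r -> {mpoly R[n]}) (h : 'I_s -> {mpoly R[n]}).
Implicit Types (y z x : 'I_n -> R).

Definition phi y : R := \sum_j (h j).@[y] ^+ 2 + \sum_i Num.max (g i).@[y] 0 ^+ 2.

Definition piece (J : {set 'I_r}) : {mpoly R[n]} := \sum_j (h j) ^+ 2 + \sum_(i in J) (g i) ^+ 2.

Lemma pieceE J y : (piece J).@[y] = \sum_j (h j).@[y] ^+ 2 + \sum_(i in J) (g i).@[y] ^+ 2.
Proof.
by rewrite mevalD !(raddf_sum (meval y)); congr (_ + _); apply: eq_bigr => i _; rewrite /= rmorphXn.
Qed.

Lemma msize_piece d J : (forall i, (msize (g i) <= d.+1)%N) ->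
  (forall j, (msize (h j) <= d.+1)%N) -> (msize (piece J) <= (2 * d).+1)%N.
Proof.
move=> hg hh.
have sq (p : {mpoly R[n]}) : (msize p <= d.+1)%N -> (msize (p ^+ 2) <= (2 * d).+1)%N.
  move=> hp; case: (eqVneq p 0) => [->|p0]; first by rewrite expr0n msize0.
  rewrite expr2 msizeM // -subn1 leq_subLR add1n.
  by apply: leq_trans (leq_add hp hp) _; rewrite addSn addnS addnn mul2n.
apply: leq_trans (msizeD_le _ _) _; rewrite geq_max; apply/andP; split.
  by apply: leq_trans (msize_sum _ _ _) _; apply/bigmax_leqP => j _; apply: sq.
by apply: leq_trans (msize_sum _ _ _) _; apply/bigmax_leqP => j _; apply: sq.
Qed.

Lemma phi_ge0 y : 0 <= phi y.
Proof. by rewrite addr_ge0 //; apply: sumr_ge0 => i _; apply: sqr_ge0. Qed.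

Lemma df_phi : df (fun e => phi (fun i : 'I_n => e i)).
Proof.
apply: dfD; apply: df_sum => i; apply: dfX; first exact: df_meval.
by apply: df_max; [exact: df_meval|exact: df_cst].
Qed.

Lemma cont_phi y : cont_at phi y.
Proof.
apply: contD; apply: cont_sum => i; apply: contX; first exact: cont_meval.
by apply: cont_max0; exact: cont_meval.
Qed.

(* [piece J], for [J] the constraints that are nonnegative at [y], touches
   [phi] from above at [y]; this replaces differentiating the maxima. *)
Lemma phi_piece y : exists2 J, (piece J).@[y] = phi y &
  exists2 d, 0 < d & forall z, near y z d -> phi z <= (piece J).@[z].
Proof.
exists [set i | 0 <= (g i).@[y]].
  rewrite pieceE /phi; congr (_ + _).
  rewrite big_mkcond; apply: eq_bigr => i _; rewrite inE.
  by case: (lerP 0 (g i).@[y]) => [hi|hi]; rewrite ?expr0n.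
have [d d0 hd] : exists2 d, 0 < d & forall z, near y z d ->
    forall i, i \in enum 'I_r -> (g i).@[y] < 0 -> (g i).@[z] < 0.
  elim: (enum 'I_r) => [|i t [d d0 hd]]; first by exists 1.
  case: (lerP 0 (g i).@[y]) => hi.
    exists d => // z /hd hz j; rewrite inE => /orP[/eqP ->|/hz //].
    by rewrite ltNge hi.
  have gi0 : 0 < - (g i).@[y] by rewrite oppr_gt0.
  have [d' d'0 hd'] := cont_meval (g i) y gi0.
  exists (Num.min d d'); first by rewrite lt_min d0.
  move=> z /near_min[/hd hz /hd' hz'] j; rewrite inE => /orP[/eqP -> _|/hz //].
  by move: hz'; rewrite ltr_norml => /andP[_]; lra.
exists d => // z hz; rewrite pieceE /phi lerD2l [X in _ <= X]big_mkcond.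
apply: ler_sum => i _; rewrite inE; case: (lerP 0 (g i).@[y]) => hi.
  by case: (lerP (g i).@[z] 0) => hz0; rewrite ?expr0n ?sqr_ge0.
have := hd z hz i; rewrite mem_enum => /(_ isT hi) /ltW gz.
by rewrite (max_r gz) expr0n.
Qed.

Definition sqdist x y : R := \sum_i (y i - x i) ^+ 2.

Lemma sqdist_ge0 x y : 0 <= sqdist x y.
Proof. by apply: sumr_ge0 => i _; apply: sqr_ge0. Qed.

Lemma sqdist_coord x y i (rr : R) : 0 <= rr -> sqdist x y <= rr ^+ 2 -> `|y i - x i| <= rr.
Proof.
move=> r0 hs; rewrite -(@ler_pXn2r _ 2) ?nnegrE //; apply: le_trans hs.
by rewrite real_normK ?num_real // /sqdist (bigD1 i) //= lerDl sumr_ge0 // => j _; apply: sqr_ge0.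
Qed.

Lemma df_sqdist x : df (fun e => sqdist x (fun i : 'I_n => e i)).
Proof. by apply: df_sum => i; df_tac. Qed.

Lemma cont_sqdist x y : cont_at (sqdist x) y.
Proof.
apply: cont_sum => i; apply: contX; apply: contD; [exact: cont_coord|exact: cont_cst].
Qed.

Definition bump x (rr : R) : {mpoly R[n]} := (rr ^+ 2)%:MP - \sum_i ('X_i - (x i)%:MP) ^+ 2.

Lemma bumpE x rr y : (bump x rr).@[y] = rr ^+ 2 - sqdist x y.
Proof.
rewrite mevalB mevalC (raddf_sum (meval y)); congr (_ - _); apply: eq_bigr => i _.
by rewrite /= rmorphXn /= mevalB mevalXU mevalC.
Qed.

Lemma bump_deriv x rr y i : ((bump x rr)^`M(i)).@[y] = - (2%:R * (y i - x i)).
Proof.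
rewrite mderivB mderivC sub0r mevalN (raddf_sum (mderiv i)) (raddf_sum (meval y)) (bigD1 i) //=.
rewrite big1 ?addr0 => [|j ji]; rewrite mderiv_exp expr1 mevalZ mevalM mderivB mderivC subr0 mderivX mnm1E.
  rewrite eqxx scale1r (_ : (U_(i) - U_(i))%MM = 0%MM) ?mpolyX0 ?meval1 ?mulr1.
    by rewrite mevalB mevalXU mevalC.
  by apply/mnmP => j; rewrite mnmBE subnn mnm0E.
by rewrite (negPf ji) scale0r meval0 !mulr0.
Qed.

Lemma descent x (rr e : R) (N0 : nat) : (0 < N0)%N -> 0 < rr ->
  (forall y, sqdist x y <= rr ^+ 2 -> 0 < phi y) -> phi x < e ->
  (forall J y, sqdist x y <= rr ^+ 2 -> 0 < (piece J).@[y] -> (piece J).@[y] < e ->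
     e * (piece J).@[y] ^+ (2 * N0).-1 <= gradsq (piece J) y ^+ N0) ->
  e * rr ^+ (2 * N0) <= (4%:R * (2 * N0)%:R ^+ 2) ^+ N0 * phi x.
Proof.
move=> N00 r0 hpos phie hgrad; set N := (2 * N0)%N.
have Np : (0 < N)%N by rewrite muln_gt0.
pose b y := rr ^+ 2 - sqdist x y.
have r2 : 0 < rr ^+ 2 by rewrite exprn_gt0.
(* Where [phi / b ^+ N] is at most its value at [x], written without division; on this closed set
   [b] stays positive. *)
pose A y := sqdist x y <= rr ^+ 2 /\ phi y * rr ^+ (2 * N) <= phi x * b y ^+ N.
have xx : sqdist x x = 0 by rewrite /sqdist big1 // => i _; rewrite subrr expr0n.
have cb y : cont_at b y by apply: contD; [exact: cont_cst|apply/contN/cont_sqdist].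
have dfb : df (fun e => b (fun i : 'I_n => e i)) by apply: dfD; [exact: df_cst|apply/dfN/df_sqdist].
have bpos y : A y -> 0 < b y.
  move=> [h1 h2]; rewrite lt_neqAle subr_ge0 h1 andbT; apply/eqP => b0.
  move: h2; rewrite -b0 expr0n eqn0Ngt Np mulr0 leNgt => /negP; apply.
  by rewrite mulr_gt0 ?exprn_gt0 ?hpos.
have px : 0 < phi x by apply: hpos; rewrite xx ltW.
have rN : 0 < rr ^+ (2 * N) by rewrite exprn_gt0.
have Ax : A x by rewrite /A xx ltW // /b xx subr0 -exprM.
have [B B0 hB] := box_of x.
have [|||||||y Ay hy] := @extreme_value _ _ A (fun y => phi y * (b y ^+ N)^-1) (B + rr).
- by apply: sa_and; apply: sa_le; do ?[exact: df_cst|exact: df_sqdist|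
    apply: dfM|exact: df_phi|apply: dfX|exact: dfb].
- by apply: dfM; [exact: df_phi|apply/df_inv/dfX].
- apply: closed_and; apply: closed_le => p; do ?[exact: cont_cst|
    exact: cont_sqdist|apply: contM|exact: cont_phi|apply: contX|exact: cb].
- move=> y [/sqdist_coord hd _] i.
  rewrite -[y i](subrK (x i)) addrC; apply: le_trans (ler_normD _ _) _.
  by apply: lerD => //; apply: hd; exact: ltW.
- move=> p Ap; apply: contM; first exact: cont_phi.
  by apply: cont_inv; [rewrite gt_eqF // exprn_gt0 // bpos|apply: contX].
- by exists x.
- by exists 0 => y Ay; rewrite mulr_ge0 ?phi_ge0 // invr_ge0 exprn_ge0 // ltW // bpos.
have by0 := bpos y Ay.
pose u := phi y / b y ^+ N.
have bN z : 0 < b z -> 0 < b z ^+ N by move=> ?; rewrite exprn_gt0.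
have phiu : phi y = u * b y ^+ N by rewrite /u divfK // gt_eqF // bN.
have ux : u * rr ^+ (2 * N) <= phi x.
  by have := hy x Ax; rewrite -/u /b xx subr0 -exprM ler_pdivlMr.
have sy : sqdist x y <= rr ^+ 2 by case: Ay.
have py : 0 < phi y by apply: hpos.
have u0 : 0 < u by rewrite divr_gt0 // bN.
(* Outside [A] but inside the open ball, the quotient exceeds its value at [x], so its minimum [u]
   is a bound wherever [b] is positive. *)
have above z : 0 < b z -> u * b z ^+ N <= phi z.
  move=> bz; rewrite -ler_pdivlMr ?bN //.
  case: (classic (A z)) => [/hy //|nA].
  have : phi x * b z ^+ N < phi z * rr ^+ (2 * N).
    rewrite ltNge; apply/negP => hA; apply: nA; split=> //.
    by rewrite -subr_ge0 ltW.
  move=> hz; rewrite ler_pdivlMr ?bN // -(ler_pM2r rN) mulrAC.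
  by apply: le_trans (ltW hz); rewrite ler_pM2r ?bN.
clearbody u.
have [J hJ [d d0 hd]] := phi_piece y.
have [d' d'0 hd'] := cb y (b y) by0.
(* Near [y], [piece J] lies above [phi], which lies above [u * b ^+ N], with equality at [y]. *)
have crit i : ((piece J - u *: bump x rr ^+ N)^`M(i)).@[y] = 0.
  apply: (@local_min_grad _ _ _ _ (Num.min d d')); first by rewrite lt_min d0.
  move=> z /near_min[/hd hz /hd' bz].
  rewrite !mevalB !mevalZ !rmorphXn /= !bumpE -!/(b _) hJ phiu subrr subr_ge0.
  apply: le_trans hz; apply: above; move: bz; rewrite ltr_norml => /andP[]; lra.
have grad i : ((piece J)^`M(i)).@[y] = - (u * (N%:R * (b y ^+ N.-1 * (2%:R * (y i - x i))))).
  have := crit i; rewrite mderivB mderivZ mevalB mevalZ -[in bump x rr ^+ N](prednK Np) mderiv_exp.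
  rewrite prednK // mevalZ mevalM rmorphXn /= bumpE bump_deriv -/(b y) => /eqP.
  by rewrite subr_eq0 => /eqP ->; ring.
have gs : gradsq (piece J) y = (2%:R * N%:R * (u * b y ^+ N.-1)) ^+ 2 * sqdist x y.
  rewrite /gradsq /sqdist mulr_sumr; apply: eq_bigr => i _; rewrite grad.
  by rewrite sqrrN -exprMn; congr (_ ^+ 2); ring.
(* This keeps the value at [y] below [e], where the gradient inequality is available. *)
have phix : phi y <= phi x.
  apply: le_trans ux; rewrite phiu ler_pM2l // [X in _ <= rr ^+ X]mulnC mulnC exprM.
  by rewrite ler_pXn2r ?nnegrE ?(ltW by0) ?(ltW r2) // gerBl sqdist_ge0.
have hg : e * phi y ^+ N.-1 <= gradsq (piece J) y ^+ N0.
  by have := hgrad J y sy; rewrite hJ; apply=> //; exact: le_lt_trans phix phie.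
(* The exponents match: [(u * b ^+ N.-1) ^+ N] is [phi ^+ N.-1 * u], so the power of [phi] cancels
   and a lower bound on [u] remains. *)
have gs2 : gradsq (piece J) y ^+ N0 <= (4%:R * N%:R ^+ 2) ^+ N0 * (rr ^+ N * (phi y ^+ N.-1 * u)).
  have -> : phi y ^+ N.-1 * u = (u * b y ^+ N.-1) ^+ N.
    rewrite phiu !exprMn -!exprM mulrAC -exprSr prednK //; congr (_ * _ ^+ _).
    exact: mulnC.
  have -> : (4%:R * N%:R ^+ 2) ^+ N0 * (rr ^+ N * (u * b y ^+ N.-1) ^+ N) =
     ((2%:R * N%:R * (u * b y ^+ N.-1)) ^+ 2 * rr ^+ 2) ^+ N0.
    rewrite /N !(exprM _ 2 N0) -!exprMn; congr (_ ^+ _); ring.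
  rewrite gs ler_pXn2r // ?nnegrE; first by rewrite ler_wpM2l // sqr_ge0.
    by apply: mulr_ge0; [exact: sqr_ge0|exact: sqdist_ge0].
  by apply: mulr_ge0; exact: sqr_ge0.
have pN : 0 < phi y ^+ N.-1 by rewrite exprn_gt0.
have : e * phi y ^+ N.-1 <= (4%:R * N%:R ^+ 2) ^+ N0 * (rr ^+ N * u) * phi y ^+ N.-1.
  apply: (le_trans hg); apply: (le_trans gs2); rewrite le_eqVlt; apply/orP; left; apply/eqP.
  by rewrite -!mulrA [u * _]mulrC.
rewrite ler_pM2r // => he.
have rNp : 0 < rr ^+ N by rewrite exprn_gt0.
move: ux; rewrite mul2n -addnn exprD => ux.
rewrite -(ler_pM2r rNp) in he; apply: le_trans he _.
rewrite -mulrA ler_wpM2l ?exprn_ge0 ?mulr_ge0 ?exprn_ge0 ?ler0n //.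
by apply: le_trans ux; rewrite le_eqVlt; apply/orP; left; apply/eqP; ring.
Qed.

Lemma uniform_pos (I : finType) (P : I -> R -> Prop) :
  (forall i a b, 0 < b -> b <= a -> P i a -> P i b) -> (forall i, exists2 a, 0 < a & P i a) ->
  exists2 a, 0 < a <= 1 & forall i, P i a.
Proof.
move=> mono ex.
suff [a a01 ha] : exists2 a, 0 < a <= 1 & forall i, i \in enum I -> P i a.
  by exists a => // i; apply: ha; rewrite mem_enum.
elim: (enum I) => [|i t [a /andP[a0 a1] IH]]; first by exists 1; rewrite ?ltr01 ?lexx.
have [b b0 hb] := ex i.
have m0 : 0 < Num.min a b by rewrite lt_min a0.
exists (Num.min a b); first by rewrite m0 ge_min a1.
move=> j; rewrite inE => /orP[/eqP ->|/IH].
  by apply: mono hb => //; rewrite ge_min lexx orbT.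
by apply: mono => //; rewrite ge_min lexx.
Qed.

Lemma sum_sqr_le (I : finType) (a : I -> R) : (forall i, 0 <= a i) ->
  \sum_i a i ^+ 2 <= (\sum_i a i) ^+ 2.
Proof.
move=> a0; rewrite [leRHS]expr2 mulr_suml; apply: ler_sum => i _.
by rewrite expr2 ler_wpM2l // (bigD1 i) //= lerDl sumr_ge0.
Qed.

Lemma residual_ge0 (x : pt R n) : 0 <= residual g h x.
Proof. by rewrite addr_ge0 //; apply: sumr_ge0 => i _; rewrite ?le_max ?lexx ?orbT. Qed.

Lemma phi_residual (x : pt R n) : phi (fun i => x ord0 i) <= residual g h x ^+ 2.
Proof.
rewrite /residual /phi.
set a := \sum_(j < s) _; set b := \sum_(i < r) _.
have ha : a <= (\sum_j `|peval (h j) x|) ^+ 2.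
  apply: le_trans (sum_sqr_le (fun j => normr_ge0 (peval (h j) x))).
  by apply: ler_sum => j _; rewrite real_normK ?num_real.
have hb : b <= (\sum_i Num.max (peval (g i) x) 0) ^+ 2.
  by apply: sum_sqr_le => i; rewrite le_max lexx orbT.
have A0 : 0 <= \sum_j `|peval (h j) x| by apply: sumr_ge0.
have B0 : 0 <= \sum_i Num.max (peval (g i) x) 0.
  by apply: sumr_ge0 => i _; rewrite le_max lexx orbT.
by have := mulr_ge0 A0 B0; rewrite sqrrD mulr2n; lra.
Qed.

Lemma phi_eq0 y : phi y <= 0 -> basic_closed g h (\row_i y i).
Proof.
have e : (fun i => (\row_j y j) ord0 i) = y.
  by apply: functional_extensionality => i; rewrite mxE.
have s1 : 0 <= \sum_j (h j).@[y] ^+ 2 by apply: sumr_ge0 => j _; exact: sqr_ge0.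
have s2 : 0 <= \sum_i Num.max (g i).@[y] 0 ^+ 2 by apply: sumr_ge0 => j _; exact: sqr_ge0.
rewrite /phi => h0; split=> i; rewrite /peval e.
  have : \sum_i Num.max (g i).@[y] 0 ^+ 2 = 0 by apply/eqP; rewrite eq_le s2 andbT; lra.
  move/psumr_eq0P => /(_ (fun j _ => sqr_ge0 _) i isT) /eqP; rewrite sqrf_eq0 => /eqP mx.
  by rewrite -mx le_max lexx.
have : \sum_j (h j).@[y] ^+ 2 = 0 by apply/eqP; rewrite eq_le s1 andbT; lra.
by move/psumr_eq0P => /(_ (fun j _ => sqr_ge0 _) i isT) /eqP; rewrite sqrf_eq0 => /eqP.
Qed.

Lemma edistE (x z : pt R n) : edist x z = Num.sqrt (sqdist (fun i => z ord0 i) (fun i => x ord0 i)).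
Proof. by []. Qed.

Lemma sqdist_sym x y : sqdist x y = sqdist y x.
Proof. by apply: eq_bigr => i _; rewrite -sqrrN opprB. Qed.

Lemma lojasiewicz d (E : pt R n -> Prop) : (forall i, deg_le (g i) d) ->
  (forall j, deg_le (h j) d) -> bounded_set E ->
  exists2 kappa : R, 0 < kappa &
    error_bound E (basic_closed g h) (residual g h) (loj_exp n (2 * d)) kappa.
Proof.
move=> dg dh [BE hBE]; set N0 := loj_exp n (2 * d).
have N00 : (0 < N0)%N by rewrite muln_gt0 expn_gt0.
(* If [M] is empty, every number is a lower bound of the distances, so [is_dist] holds for no
   [delta]. *)
case: (classic (exists m, basic_closed g h m)) => [[m0 Mm0]|noM]; last first.
  exists 1 => // x _ delta [_ hd].
  have := hd (delta + 1) (fun (y : pt R n) My => False_ind _ (noM (ex_intro _ y My))).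
  by rewrite gerDl leNgt ltr01.
pose BE' := Num.max BE 0.
have BE0 : 0 <= BE' by rewrite le_max lexx orbT.
have xB (x : pt R n) : E x -> forall i, `|x ord0 i| <= BE'.
  move=> /hBE hx i; have := @sqdist_coord (fun i => (0 : pt R n) ord0 i) (fun i => x ord0 i) i _ BE0.
  rewrite mxE subr0; apply; rewrite -ler_sqrt ?exprn_ge0 // sqrtr_sqr ger0_norm //.
  by rewrite -edistE le_max hx.
(* [S] bounds the squared distance from [E] to [m0], so [delta <= 1 + S] and the box of size [B]
   contains the balls of radius [delta / 2]. *)
pose S := \sum_i (BE' + `|m0 ord0 i|) ^+ 2.
have S0 : 0 <= S by apply: sumr_ge0 => i _; exact: sqr_ge0.
pose B := BE' + (1 + S).
have B0 : 0 <= B by rewrite /B; lra.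
(* One constant for all of the finitely many pieces; being at most [1], it also gives [e <= psi]
   whenever [e <= phi]. *)
have [e /andP[e0 e1] he] := @uniform_pos {set 'I_r} (fun J e => forall y, (forall i, `|y i| <= B) ->
   0 < (piece J).@[y] -> (piece J).@[y] < e ->
   e * (piece J).@[y] ^+ (2 * N0).-1 <= gradsq (piece J) y ^+ N0)
  (fun J a b b0 ba ha y hy f0 f1 => le_trans (ler_wpM2r (exprn_ge0 _ (ltW f0)) ba)
     (ha y hy f0 (lt_le_trans f1 ba)))
  ltac:(move=> J; have [c [eta [c0 eta0 H]]] := gradient_ineq (msize_piece J dg dh) B0;
    exists (Num.min c eta); [by rewrite lt_min c0|];
    move=> y hy f0; rewrite lt_min => /andP[_ f1]; apply: le_trans (H y hy f0 f1);
    by apply: ler_wpM2r; [exact: exprn_ge0 (ltW f0)|rewrite ge_min lexx]).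
pose K := (4%:R * (2 * N0)%:R ^+ 2) ^+ N0 : R.
have K0 : 0 <= K by rewrite exprn_ge0 // mulr_ge0 // exprn_ge0 // ler0n.
pose k1 := 2%:R ^+ (2 * N0) * K / e.
have k10 : 0 <= k1.
  by apply: divr_ge0; [apply: mulr_ge0 => //; apply: exprn_ge0; apply: ler0n|exact: ltW].
pose k2 := (1 + S) ^+ N0 / e.
have S1 : 0 < 1 + S by lra.
have k20 : 0 < k2 by rewrite divr_gt0 ?exprn_gt0.
exists (1 + k1 + k2); first by lra.
move=> x Ex delta [hd1 hd2].
set psi := residual g h x; have psi0 : 0 <= psi := residual_ge0 x.
set X := fun i => x ord0 i.
have dge0 : 0 <= delta by apply: hd2 => y _; exact: sqrtr_ge0.
have dS : delta <= 1 + S.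
  have h1 : delta ^+ 2 <= S.
    have dm := hd1 m0 Mm0; apply: (@le_trans _ _ (edist x m0 ^+ 2)).
      by rewrite ler_pXn2r ?nnegrE ?sqrtr_ge0.
    rewrite edistE sqr_sqrtr ?sqdist_ge0 //; apply: ler_sum => i _.
    rewrite -[leLHS]real_normK ?num_real // ler_pXn2r ?nnegrE ?addr_ge0 //.
    by apply: le_trans (ler_normB _ _) _; rewrite lerD2r xB.
  case: (lerP delta 1) => [|d1]; first lra.
  by apply: (@le_trans _ _ (delta ^+ 2)); [rewrite expr2 ler_peMl // ltW|lra].
(* Away from the zero set, [psi] is bounded below and [delta] above, which accounts for [k2]; close
   to it [descent] applies. *)
case: (lerP e (phi X)) => hphi.
  have hpsi : e <= psi.
    rewrite leNgt; apply/negP => pe.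
    have := phi_residual x; rewrite -/psi -/X => hp.
    have : psi ^+ 2 <= psi by rewrite expr2 ger_pMl ?psi0 //; nra.
    lra.
  apply: (@le_trans _ _ (k2 * psi)); last by rewrite ler_wpM2r //; lra.
  rewrite /k2 mulrAC ler_pdivlMr //; apply: ler_pM => //; rewrite ?exprn_ge0 ?(ltW e0) //.
  by rewrite ler_pXn2r ?nnegrE // ltW.
case: (lerP delta 0) => d0.
  have -> : delta = 0 by apply/eqP; rewrite eq_le d0 dge0.
  by rewrite expr0n eqn0Ngt N00 mulr_ge0 //; lra.
(* With half the distance as radius, the closed ball about [x] does not meet [M]. *)
have r0 : 0 < delta / 2%:R by rewrite divr_gt0.
have hpos y : sqdist X y <= (delta / 2%:R) ^+ 2 -> 0 < phi y.
  move=> hy; rewrite ltNge; apply/negP => /phi_eq0 /hd1.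
  rewrite edistE (_ : (fun i => (\row_j y j) ord0 i) = y); last first.
    by apply: functional_extensionality => i; rewrite mxE.
  rewrite -/X sqdist_sym => h1.
  have : Num.sqrt (sqdist X y) <= delta / 2%:R.
    by rewrite -[leRHS]ger0_norm ?(ltW r0) // -sqrtr_sqr ler_wsqrtr.
  lra.
have hbox y : sqdist X y <= (delta / 2%:R) ^+ 2 -> forall i, `|y i| <= B.
  move=> hy i; have := sqdist_coord i (ltW r0) hy.
  have := xB x Ex i; rewrite -/(X i) => h1 h2.
  have : `|y i| <= `|X i| + `|y i - X i| by rewrite -{1}[y i](subrK (X i)) addrC; exact: ler_normD.
  by rewrite /B; lra.
have := descent N00 r0 hpos hphi (fun J y hy => he J y (hbox y hy)).
rewrite -/K => hdesc.
have h1 : delta ^+ (2 * N0) <= k1 * phi X.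
  have dE : delta ^+ (2 * N0) = (delta / 2%:R) ^+ (2 * N0) * 2%:R ^+ (2 * N0).
    by rewrite -exprMn divfK // pnatr_eq0.
  rewrite /k1 mulrAC ler_pdivlMr // dE.
  have P2 : 0 <= 2%:R ^+ (2 * N0) :> R by apply: exprn_ge0; apply: ler0n.
  have := ler_wpM2l P2 hdesc.
  set p := 2%:R ^+ _; set q := (delta / _) ^+ _; set t := phi X => H.
  by rewrite (_ : q * p * e = p * (e * q)) 1?(_ : p * K * t = p * (K * t)) //; ring.
(* Since [phi <= psi ^+ 2], a square root turns the exponent [2 * N0] into [N0]. *)
have h2 : (delta ^+ N0) ^+ 2 <= ((1 + k1) * psi) ^+ 2.
  rewrite -exprM mulnC; apply: le_trans h1 _; rewrite exprMn.
  apply: ler_pM; rewrite ?phi_ge0 ?phi_residual //.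
  by rewrite expr2; nra.
have {}h2 : delta ^+ N0 <= (1 + k1) * psi.
  rewrite -(@ler_pXn2r _ 2) ?nnegrE ?exprn_ge0 // mulr_ge0 //; lra.
by apply: le_trans h2 _; rewrite ler_wpM2r //; lra.
Qed.

End ErrorBound.

(** * The numerical size of the exponent *)

Lemma leq_expn_base (a b n : nat) : (a <= b)%N -> (a ^ n <= b ^ n)%N.
Proof. by case: n => [|n] ab; rewrite ?expn0 ?leq_exp2r. Qed.

(** With [D = 2 d], the bounds [4 d + 1 <= 8 d] and [n + 1 <= (8 d) ^ n] already give
    [(8 d) ^ (2 n + 1)]. *)
Lemma loj_exp_le n d : (0 < d)%N -> (loj_exp n (2 * d) <= (8 * d) ^ (2 * (n + 7)))%N.
Proof.
move=> d0; rewrite /loj_exp.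
have h1 : (n.+1 <= (8 * d) ^ n)%N.
  by apply: leq_trans (ltn_expl n (ltnSn 1)) _; apply: leq_expn_base; lia.
have h2 : ((2 * (2 * d)).+1 ^ n <= (8 * d) ^ n)%N by apply: leq_expn_base; lia.
have h3 : (1 + ((2 * (2 * d)).+2 + n * (2 * (2 * d)).+1) <= n.+1 * (8 * d))%N by nia.
apply: leq_trans (leq_mul h2 (leq_trans h3 (leq_mul h1 (leqnn _)))) _.
by rewrite -expnSr -expnD leq_pexp2l; lia.
Qed.

(** [C] is chosen before the field, the dimension and the degree, so it is the absolute constant
    hidden in the exponent [O(n^2)]; the base [maxn d 2] keeps that bound meaningful for [d = 1]. *)
Theorem theorem2p9 :
  exists C : nat,
  forall (R : rcfType) (n d r s : nat) (g : 'I_r -> {mpoly R[n]})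
    (h : 'I_s -> {mpoly R[n]}) (P : seq {mpoly R[n]}) (E : pt R n -> Prop),
    (0 < d)%N ->
    (forall i, deg_le (g i) d) -> (forall j, deg_le (h j) d) ->
    (forall p, p \in P -> deg_le p d) ->
    P_semialgebraic P E -> closed_set E -> bounded_set E ->
    (exists (kappa : R) (rho : nat),
       [/\ 0 < kappa, (1 <= rho)%N, (rho <= (maxn d 2) ^ (C * n.+1 ^ 2))%N &
           error_bound E (basic_closed g h) (residual g h) rho kappa])
    /\
    ((exists sM : seq (pt R n), forall x, basic_closed g h x <-> x \in sM) ->
     exists (kappa : R) (rho : nat),
       [/\ 0 < kappa, (1 <= rho)%N, (rho <= (8 * d) ^ (2 * (n + 7)))%N &
           error_bound E (basic_closed g h) (residual g h) rho kappa]).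
Proof.
(* For [m = maxn d 2], [8 d <= m ^ 4] turns [(8 d) ^ (2 (n + 7))] into [m ^ (8 (n + 7))], and
   [8 (n + 7) <= 56 (n + 1) ^ 2]. *)
exists 56 => R n d r s g h P E d0 dg dh _ _ _ Eb.
have [kappa k0 hk] := lojasiewicz dg dh Eb.
have N0 : (1 <= loj_exp n (2 * d))%N by rewrite muln_gt0 expn_gt0.
have hN := loj_exp_le n d0.
split=> [|_]; exists kappa, (loj_exp n (2 * d)); split=> //.
apply: leq_trans hN _; set m := maxn d 2.
have m2 : (2 <= m)%N by rewrite leq_maxr.
have dm : (d <= m)%N by rewrite leq_maxl.
have h8 : (8 * d <= m ^ 4)%N.
  by rewrite (expnD m 3 1) leq_mul ?expn1 // (leq_expn_base 3 m2).
apply: leq_trans (leq_expn_base _ h8) _; rewrite -expnM leq_pexp2l //; first lia.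
by rewrite expnS expn1; nia.
Qed.
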